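(* For every infinite cardinal $\kappa$, the space $B(\kappa)$ is homeomorphic to the product $B(\kappa)\times[0,1]^{\mathbb{N}}$.
   Context: For a set $\kappa$, $B(\kappa)=\{x\in[-1,1]^\kappa:\sum_{i\in\kappa}|x_i|\le 1\}$, with the topology inherited from the product topology on $[-1,1]^\kappa$. The Hilbert cube $[0,1]^{\mathbb{N}}$ carries the product topology. *)

(* Defs.v *)
From HB Require Import structures.
From mathcomp Require Import all_boot all_order all_algebra.
From mathcomp Require Import all_classical all_reals all_analysis.

Set Implicit Arguments.
Unset Strict Implicit.
Unset Printing Implicit Defensive.

Import Order.TTheory GRing.Theory Num.Theory.
Import numFieldNormedType.Exports.

Local Open Scope classical_set_scope.
Local Open Scope ring_scope.

Definition homeomorphic (X Y : topologicalType) : Prop :=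
  exists f : X -> Y, exists g : Y -> X,
    [/\ cancel f g, cancel g f, continuous f & continuous g].

(* The set `[a, b] is coerced to the type of its elements, which carries the
   subspace topology; {ptws _ -> _} carries the product topology. *)
Definition cube (R : realType) (K : Type) : topologicalType :=
  {ptws K -> `[(-1 : R), 1]%classic}.

Definition hilbert_cube (R : realType) : topologicalType :=
  {ptws nat -> `[(0 : R), 1]%classic}.

(* The sum over K is the supremum of the finite partial sums, in \bar R. *)
Definition l1_ball_set (R : realType) (K : choiceType) : set (cube R K) :=
  [set x : K -> `[(-1 : R), 1]%classic |
    (\esum_(i in [set: K]) (`|set_val (x i)|)%:E <= 1)%E].
Arguments l1_ball_set : clear implicits.

Definition l1_ball (R : realType) (K : choiceType) : topologicalType :=
  set_type (l1_ball_set R K).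

(* Main.v *)
Require Import Defs.
From mathcomp Require Import all_boot all_order all_algebra.
From mathcomp Require Import all_classical all_reals all_analysis.
From mathcomp Require Import lra zify ring.
Set Implicit Arguments.
Unset Strict Implicit.
Unset Printing Implicit Defensive.
Import Order.TTheory GRing.Theory Num.Theory.
Import numFieldNormedType.Exports.
Local Open Scope classical_set_scope.
Local Open Scope ring_scope.

(** Write [phi x = 1 - \sum_i |x_i|] for [x] in the l1 ball [B] over nat.  With
    nat embedded in [K], a point of the ball over [K] is a pair [(x, y)] with
    [x] in [B] and [\sum_k |y_k| <= phi x].  Hence it suffices to find a
    homeomorphism [f : B -> B * [0,1]^nat] and a continuous [t > 0] such that
    [phi x = t x * phi (f x).1]: the coordinates [y] are then divided by [t x].
    The difficulty is that [phi] is only upper semicontinuous.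

    (a) The cube [[-1,1]^nat], weighted by [\prod_i (1 - |v_i|)], is
    homeomorphic to [B], weighted by [phi].  Stick breaking
    [x_k = v_k \prod_(i < k) (1 - |v_i|)] carries one weight to the other but
    is not injective where the weight vanishes; a perturbation of size [eps_k]
    at stage [k] makes it injective if [eps_k] decays fast enough.

    (b) For every [eta] there is a homeomorphism of [B] onto [[-1,1] * B] which
    multiplies [phi] by a continuous factor between [1] and [(1 - eta)^-1].  In
    [B], the distance of [x_0] to [{-1,1}] bounds the other coordinates; stage
    [k] relaxes this bound from [4^(k+1) D] to [4^(k+2) D] at the expense of
    moving the coordinate [x_(k+1)], and in the limit [x_0] becomes free.

    (c) By (a) and (b) the weighted cube absorbs a factor [[-1,1]].  The cube is
    the product of countably many copies of itself, with product weight, and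
    absorbs one factor in each copy, with [eta] summable over the copies. *)

(** * Topology *)

Section topology_facts.

Lemma cvg_ptws (T : Type) (Y : topologicalType) (I : Type) (F : set_system T)
    (f : T -> {ptws I -> Y}) (y : {ptws I -> Y}) : Filter F ->
  (forall i, f t i @[t --> F] --> y i) -> f @ F --> y.
Proof.
move=> FF fy; apply/cvg_sup => i A [B [[C oC <-] Cy] CA].
by apply: filterS CA _; apply: (fy i); exact: open_nbhs_nbhs.
Qed.

Lemma cvg_set_type (T : Type) (Y : topologicalType) (A : set Y) (F : set_system T)
    (f : T -> A) (y : A) : Filter F ->
  set_val (f t) @[t --> F] --> set_val y -> f @ F --> y.
Proof.
move=> FF fy B [D [[E oE <-] Ey] DB].
by apply: filterS DB _; apply: fy; exact: open_nbhs_nbhs.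
Qed.

Lemma continuous_ptws (X Y : topologicalType) (I : Type) (f : X -> {ptws I -> Y}) :
  (forall i, continuous (fun x => f x i)) -> continuous f.
Proof.
by move=> cf x; apply: cvg_ptws => i; exact: cf.
Qed.

Lemma continuous_set_type (X Y : topologicalType) (A : set Y) (f : X -> A) :
  continuous (set_val \o f) -> continuous f.
Proof.
by move=> cf x; apply: cvg_set_type; exact: cf.
Qed.

Lemma set_val_continuous (Y : topologicalType) (A : set Y) :
  continuous (set_val : A -> Y).
Proof. exact: initial_continuous. Qed.

Lemma ptws_proj_continuous (Y : topologicalType) (I : Type) (i : I) :
  continuous (fun x : {ptws I -> Y} => x i).
Proof. exact: (@proj_continuous {classic I} (fun=> Y) i). Qed.

Lemma hausdorff_ptws (Y : topologicalType) (I : Type) :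
  hausdorff_space Y -> hausdorff_space {ptws I -> Y}.
Proof. by move=> hY; apply: (@hausdorff_product {classic I} (fun=> Y)). Qed.

Lemma hausdorff_inj (X Y : topologicalType) (f : X -> Y) :
  hausdorff_space Y -> continuous f -> injective f -> hausdorff_space X.
Proof.
move=> hY cf fI p q pq; apply: fI; apply: hY => A B nA nB.
by have [z [Az Bz]] := pq _ _ (cf _ _ nA) (cf _ _ nB); exists (f z).
Qed.

Lemma hausdorff_pair (X Y : topologicalType) :
  hausdorff_space X -> hausdorff_space Y -> hausdorff_space (X * Y)%type.
Proof.
move=> hX hY [p p'] [q q'] pq; congr pair.
  apply: hX => A B nA nB.
  have [||z [Az Bz]] := pq (fst @^-1` A) (fst @^-1` B).
  - exact: cvg_fst.
  - exact: cvg_fst.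
  by exists z.1.
apply: hY => A B nA nB.
have [||z [Az Bz]] := pq (snd @^-1` A) (snd @^-1` B).
- exact: cvg_snd.
- exact: cvg_snd.
by exists z.2.
Qed.

Lemma continuous_after (X Y Z : topologicalType) (g : Y -> Z) (f : X -> Y) :
  continuous g -> continuous f -> continuous (fun x => g (f x)).
Proof. by move=> cg cf x; exact: (continuous_comp (cf x) (cg (f x))). Qed.

Lemma fst_continuous (X Y : topologicalType) : continuous (@fst X Y).
Proof. by move=> p; exact: cvg_fst. Qed.

Lemma snd_continuous (X Y : topologicalType) : continuous (@snd X Y).
Proof. by move=> p; exact: cvg_snd. Qed.

Lemma continuous_pair (X Y Z : topologicalType) (f : X -> Y) (g : X -> Z) :
  continuous f -> continuous g -> continuous (fun x => (f x, g x)).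
Proof. by move=> cf cg x; exact: (cvg_pair (cf x) (cg x)). Qed.

Lemma compact_set_type (Y : topologicalType) (A : set Y) :
  compact A -> compact [set: A].
Proof.
move=> cA F PF _; have /cA [|y [Ay cy]] : ProperFilter (set_val @ F).
- exact: fmap_proper_filter.
- by apply: nearW => x; exact: set_valP.
exists (SigSub (mem_set Ay)); split => // B C FB [D [[E oE <-] Ey] DC].
have FB' : F (set_val @^-1` (set_val @` B)).
  by apply: filterS FB => z Bz; exists z.
have [|z [[b Bb <-] Ez]] := cy _ E FB'; first exact: open_nbhs_nbhs.
by exists b; split => //; exact: DC.
Qed.

Lemma range_closed (X Y : topologicalType) (f : X -> Y) :
  compact [set: X] -> hausdorff_space Y -> continuous f -> closed (range f).
Proof.
move=> cX hY cf; apply: compact_closed => //; apply: continuous_compact => //.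
exact: continuous_subspaceT.
Qed.

Lemma compact_bij_homeo (X Y : topologicalType) (f : X -> Y) :
  compact [set: X] -> hausdorff_space Y -> continuous f -> injective f ->
  (forall y, exists x, f x = y) ->
  exists g : Y -> X, [/\ cancel f g, cancel g f & continuous g].
Proof.
move=> cX hY cf fI fS; have [g gK] := choice fS.
have fK : cancel f g by move=> x; apply: fI; rewrite gK.
exists g; split=> //; apply/continuous_closedP => A cA.
have -> : g @^-1` A = f @` A.
  apply/seteqP; split=> [y Ay|_ [x Ax <-]]; first by exists (g y) => //=.
  by rewrite /= fK.
apply: compact_closed => //; apply: continuous_compact; first exact: continuous_subspaceT.
exact: subclosed_compact cA cX _.
Qed.

(** Compactness makes the range closed, so hitting [y] in the limit is enough. The infinite
    constructions below are inverted only approximately, with more coordinates correct at each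
    step. *)
Lemma approx_surj (X Y : topologicalType) (f : X -> Y) (y : Y) (u : nat -> X) :
  compact [set: X] -> hausdorff_space Y -> continuous f ->
  f \o u @ \oo --> y -> exists x, f x = y.
Proof.
move=> cX hY cf fu; have cl := range_closed cX hY cf.
have [x _ <-] : range f y; last by exists x.
apply: cl => B /fu [n _ /(_ n (leqnn n)) Bn].
by exists (f (u n)); split; first by exists (u n).
Qed.

End topology_facts.

(** * Continuity of real-valued functions *)

Section real_continuity.
Context {R : realType} {X : topologicalType}.
Implicit Types f g h : X -> R.

Lemma continuous_cst (c : R) : continuous (fun _ : X => c).
Proof. by move=> x; exact: cvg_cst. Qed.

Lemma continuous_add f g : continuous f -> continuous g ->
  continuous (fun x => f x + g x).
Proof. by move=> cf cg x; exact: (cvgD (cf x) (cg x)). Qed.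

Lemma continuous_sub f g : continuous f -> continuous g ->
  continuous (fun x => f x - g x).
Proof. by move=> cf cg x; exact: (cvgB (cf x) (cg x)). Qed.

Lemma continuous_mul f g : continuous f -> continuous g ->
  continuous (fun x => f x * g x).
Proof. by move=> cf cg x; exact: (cvgM (cf x) (cg x)). Qed.

Lemma continuous_opp f : continuous f -> continuous (fun x => - f x).
Proof. by move=> cf x; exact: (cvgN (cf x)). Qed.

Lemma continuous_normr f : continuous f -> continuous (fun x => `|f x|).
Proof. by move=> cf x; exact: (cvg_norm (cf x)). Qed.

Lemma continuous_inv f : (forall x, f x != 0) -> continuous f ->
  continuous (fun x => (f x)^-1).
Proof. by move=> f0 cf x; exact: (cvgV (f0 x) (cf x)). Qed.

Lemma continuous_if_ge0 f g h : continuous f -> continuous g -> continuous h ->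
  (forall x, f x = 0 -> g x = h x) ->
  continuous (fun x => if 0 <= f x then g x else h x).
Proof.
move=> cf cg ch fgh x; apply/cvgrPdist_lt => e e0.
have /cvgrPdist_lt/(_ e e0) g1 := cg x.
have /cvgrPdist_lt/(_ e e0) h1 := ch x.
have [fx|fx|fx] := ltgtP (f x) 0.
- have : \forall y \near x, f y < 0 by apply: (cvgr_lt (f x)) fx; exact: cf.
  by apply: filterS2 h1 => y hy fy; rewrite (leNgt 0 (f y)) fy.
- have : \forall y \near x, 0 < f y by apply: (cvgr_gt (f x)) fx; exact: cf.
  by apply: filterS2 g1 => y gy fy; rewrite (ltW fy).
- near=> y; case: ifP => _; first by near: y.
  by rewrite (fgh _ fx); near: y.
Unshelve. all: by end_near. Qed.

Lemma continuous_maxr f g : continuous f -> continuous g ->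
  continuous (fun x => Num.max (f x) (g x)).
Proof.
move=> cf cg x.
by apply: (@continuous_max _ _ (f : X -> R) (g : X -> R)); [exact: cf|exact: cg].
Qed.

Lemma continuous_minr f g : continuous f -> continuous g ->
  continuous (fun x => Num.min (f x) (g x)).
Proof.
move=> cf cg x.
by apply: (@continuous_min _ _ (f : X -> R) (g : X -> R)); [exact: cf|exact: cg].
Qed.

Lemma continuous_ulim (u : nat -> X -> R) (e : nat -> R) f :
  (forall n, continuous (u n)) -> (forall n x, `|u n x - f x| <= e n) ->
  e @ \oo --> (0 : R) -> continuous f.
Proof.
move=> cu uf e0 x; apply/cvgrPdist_lt => d d0.
have d3 : 0 < d / 3 by lra.
have /cvgrPdist_lt/(_ _ d3) [n _ /(_ n (leqnn n))] := e0.
rewrite sub0r normrN => en.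
have /cvgrPdist_lt/(_ _ d3) := cu n x; apply: filterS => y uy.
have := uf n x; have := uf n y; move: en uy.
rewrite ltr_norml !ler_norml ltr_norml => /andP[_ en] /andP[? ?] /andP[? ?] /andP[? ?].
rewrite ltr_norml; apply/andP; split; lra.
Qed.

End real_continuity.

(** * The cube and the ball as compact Hausdorff spaces *)

Section spaces.
Context {R : realType}.
Implicit Types K : choiceType.

(** Truncation makes [seg] total, so a point of the cube can be formed from any real family; [segK]
    removes the truncation once the bound is known. *)
Definition clamp (x : R) : R := Num.max (-1) (Num.min 1 x).

Lemma clamp_in x : `[(-1 : R), 1]%classic (clamp x).
Proof.
rewrite /= in_itv /= /clamp le_max lexx /=.
by rewrite ge_max ge_min lexx /= andbT; lra.
Qed.

Definition seg (x : R) : `[(-1 : R), 1]%classic := SigSub (mem_set (clamp_in x)).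

Lemma segK (x : R) : `|x| <= 1 -> set_val (seg x) = x.
Proof.
rewrite ler_norml => /andP[x1 x2].
by rewrite set_valE /= /clamp min_r // max_r.
Qed.

Lemma seg_norm (j : `[(-1 : R), 1]%classic) : `|set_val j| <= 1.
Proof. by have := set_valP j; rewrite /= in_itv /= ler_norml. Qed.

Definition crd K (x : cube R K) (k : K) : R := set_val (x k).
Definition bcrd K (x : l1_ball R K) (k : K) : R := crd (set_val x) k.
Definition cube_of K (u : K -> R) : cube R K := fun k => seg (u k).

Lemma crd_norm K (x : cube R K) k : `|crd x k| <= 1.
Proof. exact: seg_norm. Qed.

Lemma cube_ofK K (u : K -> R) k : `|u k| <= 1 -> crd (cube_of u) k = u k.
Proof. exact: segK. Qed.

Lemma crd_inj K (x y : cube R K) : crd x =1 crd y -> x = y.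
Proof. by move=> xy; apply/funext => k; apply/val_inj; exact: xy. Qed.

Lemma bcrd_inj K (x y : l1_ball R K) : bcrd x =1 bcrd y -> x = y.
Proof. by move=> xy; apply/val_inj; exact: crd_inj. Qed.

Lemma crd_continuous K k : continuous (fun x : cube R K => crd x k).
Proof.
move=> x; apply: (@continuous_comp _ _ _ (fun x : cube R K => x k) set_val).
  exact: ptws_proj_continuous.
exact: set_val_continuous.
Qed.

Lemma bcrd_continuous K k : continuous (fun x : l1_ball R K => bcrd x k).
Proof.
move=> x; apply: (@continuous_comp _ _ _ (set_val : l1_ball R K -> _) (fun x => crd x k)).
  exact: set_val_continuous.
exact: crd_continuous.
Qed.

Lemma continuous_seg (X : topologicalType) (f : X -> `[(-1 : R), 1]%classic) :
  continuous (fun x => set_val (f x) : R) -> continuous f.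
Proof. exact: continuous_set_type. Qed.

Lemma continuous_cube (X : topologicalType) K (f : X -> cube R K) :
  (forall k, continuous (fun x => crd (f x) k)) -> continuous f.
Proof.
move=> cf; apply: continuous_ptws => k; apply: continuous_seg; exact: cf.
Qed.

Lemma continuous_l1_ball (X : topologicalType) K (f : X -> l1_ball R K) :
  (forall k, continuous (fun x => bcrd (f x) k)) -> continuous f.
Proof.
by move=> cf; apply: continuous_set_type; apply: continuous_cube => k; exact: cf.
Qed.

Lemma seg_hausdorff : hausdorff_space `[(-1 : R), 1]%classic.
Proof.
apply: (hausdorff_inj _ (@set_val_continuous _ `[(-1 : R), 1]%classic)).
  exact: Rhausdorff.
exact: val_inj.
Qed.

Lemma seg_compact : compact [set: `[(-1 : R), 1]%classic].
Proof. by apply: compact_set_type; exact: segment_compact. Qed.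

Lemma cube_hausdorff K : hausdorff_space (cube R K).
Proof. by apply: hausdorff_ptws; exact: seg_hausdorff. Qed.

Lemma cube_compact K : compact [set: cube R K].
Proof.
have := @tychonoff K (fun=> `[(-1 : R), 1]%classic) _ (fun=> seg_compact).
by congr compact; apply/seteqP; split.
Qed.

Lemma l1_ballP K (x : cube R K) :
  l1_ball_set R K x <-> forall s, uniq s -> \sum_(i <- s) `|crd x i| <= 1.
Proof.
split=> [xB s us|xB].
  rewrite -lee_fin -sumEFin; apply: le_trans xB; apply: esum_ge.
  exists [set` s]; first by split => //; exact/finite_seqP; exists s.
  by rewrite fsbig_seq.
apply: ge_ereal_sup => _ [F [/finite_fsetP [Y ->] _] <-].
rewrite -fsbig_seq; last exact: finmap.fset_uniq.
by rewrite sumEFin lee_fin; apply: xB; exact: finmap.fset_uniq.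
Qed.

Lemma l1_ball_hausdorff K : hausdorff_space (l1_ball R K).
Proof.
apply: (hausdorff_inj _ (@set_val_continuous _ (l1_ball_set R K))).
  exact: cube_hausdorff.
exact: val_inj.
Qed.

Lemma l1_ball_compact K : compact [set: l1_ball R K].
Proof.
apply: compact_set_type; apply: subclosed_compact (@cube_compact K) _ => //.
(* Each finite partial sum involves finitely many coordinates, so the ball is an intersection of
   closed sets. *)
have -> : l1_ball_set R K =
    \bigcap_(s in [set s | uniq s]) [set x | \sum_(i <- s) `|crd x i| <= 1].
  by apply/seteqP; split=> x /l1_ballP.
apply: closed_bigI => s _.
apply: (@closed_comp _ _ (fun x : cube R K => \sum_(i <- s) `|crd x i|) [set y | y <= 1]).
  move=> x _.
  apply: (@continuous_big R _ _ _ _ add_continuous) => i _ y.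
  have c := @crd_continuous K i y; exact: (cvg_norm c).
exact: closed_le.
Qed.

End spaces.

(** * Infinite products *)

Section sequences_facts.
Context {R : realType}.
Implicit Types (u b c : nat -> R).

Lemma mono_cvg u M : (forall n, u n <= u n.+1) -> (forall n, u n <= M) ->
  cvgn u.
Proof.
move=> um uM; apply: nondecreasing_is_cvgn; first exact/nondecreasing_seqP.
by exists M => _ [n _ <-].
Qed.

Lemma cvg_le_cst u (l M : R) : u @ \oo --> l -> (forall n, u n <= M) -> l <= M.
Proof.
move=> ul uM; rewrite -(cvg_lim (@Rhausdorff R) ul).
by apply: limr_le; [exact: cvgP ul|exact: nearW].
Qed.

Lemma cvg_ge_cst u (l M : R) : u @ \oo --> l -> (forall n, M <= u n) -> M <= l.
Proof.
move=> ul uM; rewrite -(cvg_lim (@Rhausdorff R) ul).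
by apply: limr_ge; [exact: cvgP ul|exact: nearW].
Qed.

Lemma cvg_uniq u (l m : R) : u @ \oo --> l -> u @ \oo --> m -> l = m.
Proof.
move=> ul um.
by rewrite -(cvg_lim (@Rhausdorff R) ul) -(cvg_lim (@Rhausdorff R) um).
Qed.

Lemma cvg0_le u b : (forall n, `|u n| <= b n) -> b @ \oo --> (0 : R) ->
  u @ \oo --> (0 : R).
Proof.
move=> ub /cvgrPdist_lt b0; apply/cvgrPdist_lt => e /b0.
apply: filterS => n; rewrite !sub0r !normrN => be.
by apply: le_lt_trans be; apply: le_trans (ub n) (ler_norm _).
Qed.

Lemma geom_cvg0 (a z : R) : 0 <= z < 1 -> (fun n => a * z ^+ n) @ \oo --> (0 : R).
Proof.
move=> /andP[z0 z1]; rewrite -[0](mulr0 a); apply: cvgMr.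
by apply: cvg_expr; rewrite ger0_norm.
Qed.

Definition pprod b n : R := \prod_(i < n) b i.
Definition pinf b : R := lim (pprod b @ \oo).

Section inf_product.
Variable b : nat -> R.
Hypothesis b01 : forall n, 0 <= b n <= 1.

Lemma pprod_ge0 n : 0 <= pprod b n.
Proof. by apply: prodr_ge0 => i _; case/andP: (b01 i). Qed.

Lemma pprodS n : pprod b n.+1 = pprod b n * b n.
Proof. by rewrite /pprod big_ord_recr. Qed.

Lemma pprod_decr n : pprod b n.+1 <= pprod b n.
Proof. by rewrite pprodS ler_piMr ?pprod_ge0 //; case/andP: (b01 n). Qed.

Lemma pprod_le1 n : pprod b n <= 1.
Proof.
elim: n => [|n IH]; first by rewrite /pprod big_ord0.
exact: le_trans (pprod_decr n) IH.
Qed.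

Lemma pinf_cvg : pprod b @ \oo --> pinf b.
Proof.
apply: nonincreasing_is_cvgn; first by apply/nonincreasing_seqP; exact: pprod_decr.
by exists 0 => _ [n _ <-]; exact: pprod_ge0.
Qed.

Lemma pprod_mono n m : (n <= m)%N -> pprod b m <= pprod b n.
Proof.
by move=> nm; apply: (nonincreasing_seqP (pprod b)).1 => //; exact: pprod_decr.
Qed.

Lemma pinf_le n : pinf b <= pprod b n.
Proof.
have /cvg_le_cst : (fun m => pprod b (m + n)) @ \oo --> pinf b.
  by rewrite cvg_shiftn; exact: pinf_cvg.
by apply => m; apply: pprod_mono; exact: leq_addl.
Qed.

Lemma pinf_ge0 : 0 <= pinf b.
Proof. by apply: (cvg_ge_cst pinf_cvg) => n; exact: pprod_ge0. Qed.

Lemma pinf_le1 : pinf b <= 1.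
Proof. by apply: (cvg_le_cst pinf_cvg) => n; exact: pprod_le1. Qed.

(** The partial product is at most 1, so a further factor [b i] lowers it by at most [1 - b i]. *)
Lemma pprod_tail n m e : (forall k, \sum_(i < k) (1 - b (n + i)%N) <= e) ->
  pprod b n - e <= pprod b (m + n).
Proof.
move=> he; apply: le_trans (_ : pprod b n - \sum_(i < m) (1 - b (n + i)%N) <= _).
  by rewrite lerD2l lerN2.
elim: m => [|m IH]; first by rewrite big_ord0 subr0 add0n.
rewrite addSn pprodS big_ord_recr /= addnC.
have := pprod_le1 (n + m); have := pprod_ge0 (n + m).
by have /andP[] := b01 (n + m); move: IH; rewrite addnC; nra.
Qed.

Lemma pinf_tail n e : (forall k, \sum_(i < k) (1 - b (n + i)%N) <= e) ->
  `|pprod b n - pinf b| <= e.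
Proof.
move=> he; rewrite ger0_norm ?subr_ge0 ?pinf_le // lerBlDr -lerBlDl.
have /cvg_ge_cst : (fun m => pprod b (m + n)) @ \oo --> pinf b.
  by rewrite cvg_shiftn; exact: pinf_cvg.
by apply => m; exact: pprod_tail.
Qed.

Lemma pinf_ge e : (forall k, \sum_(i < k) (1 - b i) <= e) -> 1 - e <= pinf b.
Proof.
move=> /(@pinf_tail 0); rewrite ler_norml /pprod big_ord0 => /andP[_]; lra.
Qed.

Lemma pinf_fin n : (forall i, (n <= i)%N -> b i = 1) -> pinf b = pprod b n.
Proof.
move=> bn; have := @pinf_tail n 0; rewrite normr_le0 subr_eq0 => H.
apply/esym/eqP/H => k; rewrite big1 // => i _.
by rewrite bn ?subrr // leq_addr.
Qed.

End inf_product.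

Lemma pinf_rec b : (forall n, 0 <= b n <= 1) -> pinf b = b 0%N * pinf (fun n => b n.+1).
Proof.
move=> b01; apply: (@cvg_uniq (fun n => pprod b n.+1)).
  by rewrite cvg_shiftS; exact: pinf_cvg.
under eq_cvg do rewrite /pprod big_ord_recl /=.
by apply: cvgMr; apply: pinf_cvg.
Qed.

Lemma pinfM b c : (forall n, 0 <= b n <= 1) -> (forall n, 0 <= c n <= 1) ->
  pinf (fun n => b n * c n) = pinf b * pinf c.
Proof.
move=> b01 c01; apply: (@cvg_uniq (pprod (fun n => b n * c n))).
  apply: pinf_cvg => n.
  have := b01 n; have := c01 n => /andP[? ?] /andP[? ?].
  by rewrite mulr_ge0 // mulr_ile1.
under eq_cvg do rewrite /pprod big_split /=.
by apply: cvgM; apply: pinf_cvg.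
Qed.

(** Uniformly small tail sums of [1 - f n x] make the partial products converge uniformly in [x]. *)
Lemma pinf_continuous (X : topologicalType) (f : nat -> X -> R) (e : nat -> R) :
  (forall n x, 0 <= f n x <= 1) -> (forall n, continuous (f n)) ->
  (forall x n k, \sum_(i < k) (1 - f (n + i)%N x) <= e n) ->
  e @ \oo --> (0 : R) -> continuous (fun x => pinf (f^~ x)).
Proof.
move=> f01 cf fe e0.
apply: (@continuous_ulim _ _ (fun n x => pprod (f^~ x) n) e) => //.
  move=> n; rewrite /pprod.
  by apply: (@continuous_big R _ _ _ _ mul_continuous) => i _; exact: cf.
by move=> n x; apply: pinf_tail => // k; exact: fe.
Qed.

End sequences_facts.

(** * The l1 ball over nat *)

Section ball_weight.
Context {R : realType}.
Implicit Types u : nat -> R.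

Definition psum u n : R := \sum_(i < n) `|u i|.
Definition phi u : R := 1 - lim (psum u @ \oo).
Definition l1le1 u := forall n, psum u n <= 1.

Lemma psumS u n : psum u n.+1 = psum u n + `|u n|.
Proof. by rewrite /psum big_ord_recr. Qed.

Lemma psum0 u : psum u 0 = 0.
Proof. by rewrite /psum big_ord0. Qed.

Lemma psum_incr u n : psum u n <= psum u n.+1.
Proof. by rewrite psumS lerDl. Qed.

Lemma psum_mono u n m : (n <= m)%N -> psum u n <= psum u m.
Proof.
by move=> nm; apply: (nondecreasing_seqP (psum u)).1 => //; exact: psum_incr.
Qed.

Lemma psum_ge0 u n : 0 <= psum u n.
Proof. by rewrite /psum sumr_ge0. Qed.

Lemma phi_cvg u : l1le1 u -> psum u @ \oo --> 1 - phi u.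
Proof.
move=> u1; rewrite /phi subKr; apply: (mono_cvg (M := 1)) => //; exact: psum_incr.
Qed.

Lemma psum_le_phi u n : l1le1 u -> psum u n <= 1 - phi u.
Proof.
move=> u1; have /cvg_ge_cst : (fun m => psum u (m + n)) @ \oo --> 1 - phi u.
  by rewrite cvg_shiftn; exact: phi_cvg.
by apply => m; apply: psum_mono; exact: leq_addl.
Qed.

Lemma phi_ge u (c : R) : l1le1 u -> (forall n, psum u n <= 1 - c) -> c <= phi u.
Proof.
by move=> u1 uc; have := cvg_le_cst (phi_cvg u1) uc; lra.
Qed.

Lemma phiE u (c : R) : psum u @ \oo --> 1 - c -> phi u = c.
Proof.
by move=> uc; rewrite /phi (cvg_lim (@Rhausdorff R) uc) subKr.
Qed.

Lemma eq_phi u v : u =1 v -> phi u = phi v.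
Proof. by move=> /funext ->. Qed.

Lemma l1le1_norm u : l1le1 u -> forall n, `|u n| <= 1.
Proof.
by move=> u1 n; apply: le_trans (u1 n.+1); rewrite psumS lerDr psum_ge0.
Qed.

Lemma sum_le_psum u (s : seq nat) : uniq s -> exists n, \sum_(i <- s) `|u i| <= psum u n.
Proof.
move=> us; exists (\max_(i <- s) i).+1; set n := (\max_(i <- s) i).+1.
rewrite /psum -(big_mkord xpredT (fun i => `|u i|)) /index_iota subn0.
have sn i : i \in s -> (i < n)%N.
  by move=> si; rewrite ltnS; apply: (@leq_bigmax_seq _ s xpredT (fun j => j) i).
rewrite (perm_big [seq i <- iota 0 n | i \in s]); last first.
  apply: uniq_perm => [//||].
    by rewrite filter_uniq ?iota_uniq.
  move=> i; rewrite mem_filter mem_iota add0n.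
  by case si: (i \in s) => //=; rewrite sn.
rewrite big_filter [leRHS](bigID (fun i => i \in s)) lerDl.
exact: sumr_ge0.
Qed.

Lemma l1_ball_natP (x : cube R nat) : l1_ball_set R nat x <-> l1le1 (crd x).
Proof.
rewrite l1_ballP; split=> [xB n|xB s us].
  have := xB (iota 0 n) (iota_uniq _ _).
  by rewrite -{1}(subn0 n) -/(index_iota 0 n) big_mkord.
by have [n /le_trans] := sum_le_psum (crd x) us; apply.
Qed.

Lemma bcrd_le1 (x : l1_ball R nat) : l1le1 (bcrd x).
Proof. by apply/l1_ball_natP; exact: set_valP. Qed.

Lemma cube_of_l1 u : l1le1 u -> l1_ball_set R nat (cube_of u).
Proof.
move=> u1; apply/l1_ball_natP => n.
suff -> : psum (crd (cube_of u)) n = psum u n by exact: u1.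
by apply: eq_bigr => i _; rewrite cube_ofK //; exact: l1le1_norm.
Qed.

Definition ball_of u (u1 : l1le1 u) : l1_ball R nat :=
  SigSub (mem_set (cube_of_l1 u1)).

Lemma ball_ofK u (u1 : l1le1 u) n : bcrd (ball_of u1) n = u n.
Proof. by rewrite /bcrd /ball_of set_valE /= cube_ofK //; exact: l1le1_norm. Qed.

Lemma bcrd_norm K (x : l1_ball R K) k : `|bcrd x k| <= 1.
Proof. exact: crd_norm. Qed.

Lemma cvg_l1_ball K (y : l1_ball R K) (x : nat -> l1_ball R K) :
  (forall k, (fun n => bcrd (x n) k) @ \oo --> bcrd y k) -> x @ \oo --> y.
Proof.
move=> xy; apply: cvg_set_type; apply: cvg_ptws => k; apply: cvg_set_type.
exact: xy.
Qed.

End ball_weight.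

(** * The cube and the ball *)

Section collapsing.
Context {R : realType}.
Implicit Types v : nat -> R.

(* The gap between two candidate preimages may be squared at every stage, so
   [eps] has to decay faster than every [d ^ (2 ^ m)] with [d < 1]. *)
Definition eps (m : nat) : R := 2^-1 ^+ (m * 2 ^ m + 2).

Lemma eps_gt0 m : 0 < eps m.
Proof. by rewrite exprn_gt0 // invr_gt0. Qed.

Lemma half_expr_mono (m n : nat) : (m <= n)%N -> (2^-1 : R) ^+ n <= 2^-1 ^+ m.
Proof. by move=> mn; apply: ler_wiXn2l => //; lra. Qed.

Lemma eps_le4 m : eps m <= 4^-1.
Proof.
apply: le_trans (half_expr_mono (leq_addl _ 2)) _.
by rewrite expr2 -invfM -natrM.
Qed.

Lemma eps_half m : eps m.+1 <= eps m / 2.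
Proof.
rewrite mulrC -exprS; apply: half_expr_mono.
by have := expn_gt0 2 m; rewrite expnS; nia.
Qed.

Lemma eps_sum m k : \sum_(i < k) eps (m + i) <= 2 * eps m.
Proof.
suff : \sum_(i < k) eps (m + i) <= 2 * eps m - 2 * eps (m + k).
  by have := eps_gt0 (m + k); lra.
elim: k => [|k IH]; first by rewrite big_ord0 addn0; have := eps_gt0 m; lra.
by rewrite big_ord_recr /= addnS; have := eps_half (m + k); lra.
Qed.

Lemma eps_le_half m : eps m <= 2^-1 ^+ m.
Proof. by apply: half_expr_mono; have := ltn_expl m (ltnSn 1); nia. Qed.

Lemma half_cvg0 : (fun n => (2^-1 : R) ^+ n) @ \oo --> (0 : R).
Proof. by apply: cvg_expr; rewrite gtr0_norm ?invr_gt0 // invf_lt1 // ltr1n. Qed.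

Lemma eps_cvg0 : (fun n => 2 * eps n) @ \oo --> (0 : R).
Proof.
apply: (@cvg0_le _ _ (fun n => 2 * 2^-1 ^+ n)); last by apply: geom_cvg0; lra.
move=> n; rewrite ger0_norm; first by rewrite ler_pM2l // eps_le_half.
by rewrite mulr_ge0 // ltW // eps_gt0.
Qed.

(** By iterated squaring, [(d k / 2) ^ (2 ^ j) <= d (k + j) / 2]. If [d k > 0], then
    [2^-j <= d k / 2] for some [j], so the left side is at least [2 ^ (- j 2 ^ j)], while
    [eps (k + j)] is at most a quarter of that. *)
Lemma eps_superexp (d : nat -> R) : (forall k, 0 <= d k <= 4 * eps k) ->
  (forall k, d k ^+ 2 / 2 <= d k.+1) -> forall k, d k = 0.
Proof.
move=> deps dS k; apply/eqP; rewrite eq_le; have /andP[-> _] := deps k.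
rewrite andbT leNgt; apply/negP => dk0.
have pow j : (d k / 2) ^+ (2 ^ j) <= d (k + j)%N / 2.
  elim: j => [|j IH]; first by rewrite expn0 expr1 addn0.
  have d0 : 0 <= d k / 2 by lra.
  rewrite expnS mulnC exprM addnS; have := dS (k + j)%N.
  suff : ((d k / 2) ^+ (2 ^ j)) ^+ 2 <= (d (k + j)%N / 2) ^+ 2 by lra.
  by rewrite lerXn2r // ?nnegrE ?exprn_ge0 //; apply: le_trans IH; rewrite exprn_ge0.
have [j jd] : exists j, (2^-1 : R) ^+ j <= d k / 2.
  have /cvgrPdist_le/(_ (d k / 2)) [|j _ /(_ j (leqnn j))] := half_cvg0; first lra.
  by rewrite sub0r normrN => H; exists j; apply: le_trans H; exact: ler_norm.
have H1 : ((2^-1 : R) ^+ j) ^+ (2 ^ j) <= (d k / 2) ^+ (2 ^ j).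
  by rewrite lerXn2r // nnegrE; [rewrite exprn_ge0|lra].
have H2 : eps (k + j) <= ((2^-1 : R) ^+ j) ^+ (2 ^ j) * 4^-1.
  have -> : (4^-1 : R) = 2^-1 ^+ 2 by rewrite expr2 -invfM -natrM.
  rewrite -exprM -exprD; apply: half_expr_mono.
  by rewrite leq_add2r leq_mul ?leq_addl // leq_exp2l // leq_addl.
have H3 : 0 < ((2^-1 : R) ^+ j) ^+ (2 ^ j) by rewrite !exprn_gt0.
by have := pow j; have /andP[_] := deps (k + j)%N; lra.
Qed.

(* Stage [k] is the map [(x, a) |-> ((1 - eps k |a|) x, a (1 - (1 - eps k) |x|))],
   for which [1 - |(x', a')| = (1 - |x|) (1 - |a|)].  [stick v k] is the weight
   after [k] stages and [shr v k] is the factor by which all the stages from [k]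
   on shrink the coordinates below [k]. *)
Definition in_cube v := forall k, `|v k| <= 1.
Definition stick v k : R := pprod (fun i => 1 - `|v i|) k.
Definition shr v k : R := pinf (fun n => 1 - eps (k + n) * `|v (k + n)%N|).
Definition collapse v k : R := v k * (eps k + (1 - eps k) * stick v k) * shr v k.+1.

Section fixed.
Variable v : nat -> R.
Hypothesis v1 : in_cube v.

Lemma stick_fact01 i : 0 <= 1 - `|v i| <= 1.
Proof. by have := v1 i; have := normr_ge0 (v i); lra. Qed.

Lemma stick_ge0 k : 0 <= stick v k.
Proof. exact/pprod_ge0/stick_fact01. Qed.

Lemma stick_le1 k : stick v k <= 1.
Proof. exact/pprod_le1/stick_fact01. Qed.

Lemma stickS k : stick v k.+1 = stick v k * (1 - `|v k|).
Proof. exact: pprodS. Qed.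

Lemma stick0 : stick v 0 = 1.
Proof. by rewrite /stick /pprod big_ord0. Qed.

Lemma shr_fact01 k : 0 <= 1 - eps k * `|v k| <= 1.
Proof.
have := eps_gt0 k; have := eps_le4 k; have := v1 k; have := normr_ge0 (v k); nra.
Qed.

Lemma shr_sum m k :
  \sum_(i < k) (1 - (1 - eps (m + i) * `|v (m + i)%N|)) <= 2 * eps m.
Proof.
apply: le_trans (eps_sum m k); apply: ler_sum => i _.
by rewrite subKr ler_piMr // ltW // eps_gt0.
Qed.

Lemma shr_ge k : 1 - 2 * eps k <= shr v k.
Proof. by apply: pinf_ge => [n|n]; [exact: shr_fact01|exact: shr_sum]. Qed.

Lemma shr_le1 k : shr v k <= 1.
Proof. by apply: pinf_le1 => n; exact: shr_fact01. Qed.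

Lemma shr_gt0 k : 0 < shr v k.
Proof. by have := shr_ge k; have := eps_le4 k; lra. Qed.

Lemma shrS k : shr v k = (1 - eps k * `|v k|) * shr v k.+1.
Proof.
rewrite /shr pinf_rec => [|n]; last exact: shr_fact01.
rewrite addn0; congr (_ * pinf _); apply/funext => n.
by rewrite addnS addSn.
Qed.

Lemma shr_cvg1 : shr v @ \oo --> (1 : R).
Proof.
apply/subr_cvg0; apply: cvg0_le eps_cvg0 => n.
by rewrite distrC ger0_norm ?subr_ge0 ?shr_le1 //; have := shr_ge n; lra.
Qed.

Lemma collapse_norm k :
  `|collapse v k| = `|v k| * (eps k + (1 - eps k) * stick v k) * shr v k.+1.
Proof.
have H : 0 <= eps k + (1 - eps k) * stick v k.
  apply: addr_ge0; first exact: ltW (eps_gt0 k).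
  by apply: mulr_ge0 (stick_ge0 k); have := eps_le4 k; lra.
by rewrite !normrM (ger0_norm (ltW (shr_gt0 _))) (ger0_norm H).
Qed.

(** After [k] stages the first [k] coordinates sum to [1 - stick v k] in absolute value, and the
    later stages only rescale them. *)
Lemma psum_collapse k : psum (collapse v) k = (1 - stick v k) * shr v k.
Proof.
elim: k => [|k IH]; first by rewrite psum0 stick0 subrr mul0r.
rewrite psumS IH collapse_norm stickS shrS; ring.
Qed.

Lemma collapse_l1le1 : l1le1 (collapse v).
Proof.
move=> n; rewrite psum_collapse.
have := shr_le1 n; have := shr_gt0 n; have := stick_ge0 n; have := stick_le1 n; nra.
Qed.

(** In the limit the factor [shr v k] tends to 1, so the perturbation leaves the weight of plain
    stick breaking intact. *)
Lemma phi_collapse : phi (collapse v) = pinf (fun i => 1 - `|v i|).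
Proof.
apply: phiE; have -> : psum (collapse v) = fun k => (1 - stick v k) * shr v k.
  by apply/funext => k; exact: psum_collapse.
rewrite -[X in _ --> X]mulr1; apply: cvgM shr_cvg1.
by apply: cvgB; [exact: cvg_cst|exact/pinf_cvg/stick_fact01].
Qed.

End fixed.

End collapsing.

(** * Injectivity of the perturbed stick breaking *)

Section collapsing_injective.
Context {R : realType}.
Implicit Types v w : nat -> R.

(** One stage for two candidate preimages: [a] is the modulus of the coordinate, [P] the weight
    before the stage, [r] the later shrinking. If [a' < a], equal coordinates force [P < P'] and
    equal partial sums force [P' (1 - a') <= P (1 - a)], which are incompatible. *)
Lemma fold_mono (e a a' P P' r r' : R) : 0 < e <= 4^-1 ->
  0 <= a <= 1 -> 0 <= a' <= 1 -> 0 <= P <= 1 -> 0 <= P' <= 1 -> 0 < r' -> r' <= r ->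
  a * (e + (1 - e) * P) * r = a' * (e + (1 - e) * P') * r' ->
  (1 - P * (1 - a)) * r = (1 - P' * (1 - a')) * r' -> a <= a'.
Proof.
move=> /andP[e0 e4] /andP[a0 a1] /andP[a'0 a'1] /andP[P0 P1] /andP[P'0 P'1] r0 rr E1 E2.
rewrite leNgt; apply/negP => aa.
have PP : P < P'.
  rewrite ltNge; apply/negP => PP.
  suff : a' * (e + (1 - e) * P') * r' < a * (e + (1 - e) * P) * r by rewrite E1 ltxx.
  have m' : 0 < e + (1 - e) * P' by apply: ltr_pwDl => //; apply: mulr_ge0; lra.
  have mm : e + (1 - e) * P' <= e + (1 - e) * P by rewrite lerD2l ler_wpM2l; lra.
  apply: lt_le_trans (_ : a * (e + (1 - e) * P') * r' <= _).
    by rewrite ltr_pM2r // ltr_pM2r.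
  apply: ler_pM => //; first by rewrite mulr_ge0 // ltW.
    exact: ltW.
  by rewrite ler_wpM2l.
have QQ : P' * (1 - a') <= P * (1 - a).
  rewrite leNgt; apply/negP => QQ.
  suff : (1 - P' * (1 - a')) * r' < (1 - P * (1 - a)) * r by rewrite E2 ltxx.
  apply: lt_le_trans (_ : (1 - P * (1 - a)) * r' <= _).
    by rewrite ltr_pM2r //; lra.
  rewrite ler_wpM2l //; nra.
nra.
Qed.

(** The next gap is [(P - P') (1 - a) + P' (a' - a)], hence at least [(P - P') (1 - a)]. Since
    [a' <= 1], the equation makes [1 - a] at least half the gap, whence the square. The linear bound
    compares [a P] with [a' P'] up to an error of order [e]. *)
Lemma fold_gap (e a a' P P' r r' : R) : 0 < e <= 4^-1 ->
  0 <= a <= 1 -> 0 <= a' <= 1 -> 0 <= P <= 1 -> 0 <= P' <= 1 -> 0 < r' -> r' <= r ->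
  a <= a' -> P' <= P ->
  a * (e + (1 - e) * P) * r = a' * (e + (1 - e) * P') * r' ->
  (P - P') ^+ 2 / 2 <= P * (1 - a) - P' * (1 - a') /\
  P - P' - 2 * e <= P * (1 - a) - P' * (1 - a').
Proof.
move=> /andP[e0 e4] /andP[a0 a1] /andP[a'0 a'1] /andP[P0 P1] /andP[P'0 P'1] r0 rr aa PP E1.
have am : a * (e + (1 - e) * P) <= a' * (e + (1 - e) * P').
  rewrite -(ler_pM2r r0) -E1 ler_wpM2l //.
  by rewrite mulr_ge0 // addr_ge0 ?mulr_ge0; lra.
split; last by nra.
have a2 : (P - P') / 2 <= 1 - a.
  have H1 : a' * (e + (1 - e) * P') <= e + (1 - e) * P'.
    by rewrite ler_piMl // addr_ge0 ?mulr_ge0; lra.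
  have H2 : (1 - a) * (e + (1 - e) * P) <= 1 - a.
    by rewrite ler_piMr; nra.
  nra.
nra.
Qed.

Section two.
Variables v w : nat -> R.
Hypotheses (v1 : in_cube v) (w1 : in_cube w) (vw : collapse v =1 collapse w).

Lemma collapse_eq1 k : `|v k| * (eps k + (1 - eps k) * stick v k) * shr v k.+1 =
  `|w k| * (eps k + (1 - eps k) * stick w k) * shr w k.+1.
Proof. by rewrite -!collapse_norm // vw. Qed.

Lemma collapse_eq2 k : (1 - stick v k) * shr v k = (1 - stick w k) * shr w k.
Proof. by rewrite -!psum_collapse //; congr psum; exact/funext. Qed.

Lemma eps_bounds k : 0 < (eps k : R) <= 4^-1.
Proof. by rewrite eps_gt0 eps_le4. Qed.

Lemma norm01 u k : in_cube u -> 0 <= `|u k : R| <= 1.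
Proof. by move=> u1; rewrite normr_ge0 u1. Qed.

Lemma stick01 u k : in_cube u -> 0 <= stick u k <= (1 : R).
Proof. by move=> u1; rewrite stick_ge0 // stick_le1. Qed.

(** By [fold_mono] the larger later factor goes with the smaller coordinate, which in turn shrinks
    less at stage [k]; so the comparison propagates downwards. *)
Lemma collapse_down k : shr w k.+1 <= shr v k.+1 -> `|v k| <= `|w k| /\ shr w k <= shr v k.
Proof.
move=> ws; have vk : `|v k| <= `|w k|.
  have := collapse_eq2 k.+1; rewrite !stickS; move: (collapse_eq1 k).
  by apply: fold_mono ws; rewrite ?eps_bounds ?norm01 ?stick01 ?shr_gt0.
split => //; rewrite (shrS v1 k) (shrS w1 k); apply: ler_pM => //.
- by case/andP: (shr_fact01 w1 k).
- exact/ltW/shr_gt0.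
- by rewrite lerD2l lerN2 ler_wpM2l // ltW // eps_gt0.
Qed.

Lemma shr_down k j : (j <= k)%N -> shr w k <= shr v k -> shr w j <= shr v j.
Proof.
move=> /subnK <-; elim: (k - j)%N => [//|d IH].
by rewrite addSn => /collapse_down[_ /IH].
Qed.

Lemma collapse_inj_le : (forall k, shr w k <= shr v k) -> v =1 w.
Proof.
move=> ws; have vw1 k : `|v k| <= `|w k| by case: (collapse_down (ws k.+1)).
have rr k : stick w k <= stick v k.
  have := collapse_eq2 k; have := shr_gt0 w1 k; have := ws k.
  have /andP[] := stick01 k v1; have /andP[] := stick01 k w1; nra.
(* The linear bound of [fold_gap], summed up to the limit [d -> 0], gives [d k <= 4 eps k]; the
   quadratic bound then leaves only [d = 0]. *)
pose d k := stick v k - stick w k.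
have dgap k : d k ^+ 2 / 2 <= d k.+1 /\ d k - 2 * eps k <= d k.+1.
  rewrite /d !stickS //; apply: fold_gap (ws k.+1) (vw1 k) (rr k) (collapse_eq1 k);
  by rewrite ?eps_bounds ?norm01 ?stick01 ?shr_gt0.
have dlim : d @ \oo --> (0 : R).
  have -> : 0 = pinf (fun i => 1 - `|v i|) - pinf (fun i => 1 - `|w i|).
    by rewrite -!phi_collapse // (eq_phi vw) subrr.
  by apply: cvgB; apply: pinf_cvg; exact: stick_fact01.
have d0 k : d k = 0.
  apply: eps_superexp k => k; last by case: (dgap k).
  rewrite subr_ge0 rr /= -subr_le0.
  have : (fun m => d (m + k)%N) @ \oo --> (0 : R) by rewrite cvg_shiftn.
  move=> /cvg_ge_cst; apply => m.
  suff : d k - 2 * (\sum_(i < m) eps (k + i)) <= d (m + k)%N.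
    by have := @eps_sum R k m; rewrite /d; lra.
  elim: m => [|m IH]; first by rewrite big_ord0 mulr0 subr0.
  rewrite big_ord_recr addSn /=; have [_] := dgap (m + k)%N.
  by rewrite [X in eps X]addnC; lra.
move=> k; have rk : stick v k.+1 = stick w k.+1 by have := d0 k.+1; rewrite /d; lra.
have rk' : stick v k = stick w k by have := d0 k; rewrite /d; lra.
(* The shrink factors can be compared only through a nonzero partial sum; if that sum is zero, so
   are [v k] and [w k]. *)
have [r1|r1] := eqVneq (stick v k.+1) 1.
  have z u : in_cube u -> stick u k.+1 = 1 -> u k = 0.
    move=> u1; rewrite stickS // => H; apply/normr0_eq0/le_anti.
    rewrite normr_ge0 andbT -(subKr 1 `|u k|) subr_le0 -{1}H ler_piMl ?stick_le1 //.
    by rewrite subr_ge0.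
  by rewrite !z // -rk.
have sk : shr v k.+1 = shr w k.+1.
  have := collapse_eq2 k.+1; rewrite rk; apply: mulfI.
  by rewrite subr_eq0 eq_sym -rk.
have := vw k; rewrite /collapse rk' sk -!mulrA; apply: mulIf.
have := shr_gt0 w1 k.+1; have /andP[e0 e4] := eps_bounds k.
have /andP[p0 _] := stick01 k w1; move=> s0.
rewrite mulf_neq0 //; apply: lt0r_neq0 => //.
by apply: ltr_pwDl => //; apply: mulr_ge0; lra.
Qed.

End two.

(** A strict comparison of the shrink factors at one index fixes its direction at all indices by
    [shr_down]; up to exchanging [v] and [w], [collapse_inj_le] applies. *)
Lemma collapse_inj v w : in_cube v -> in_cube w -> collapse v =1 collapse w -> v =1 w.
Proof.
move=> v1 w1 vw; have [ws|/existsNP[k /negP]] := pselect (forall k, shr w k <= shr v k).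
  exact: collapse_inj_le.
rewrite -ltNge => ks; apply: fsym; apply: collapse_inj_le => // j.
have [jk|kj] := leqP j k.
  by apply: shr_down jk (ltW ks) => // i; rewrite vw.
rewrite leNgt; apply/negP => sj.
by have := shr_down v1 w1 vw (ltnW kj) (ltW sj); rewrite leNgt ks.
Qed.

End collapsing_injective.

(** * Surjectivity, and the homeomorphism of the cube with the ball *)

Section collapsing_homeo.
Context {R : realType}.
Implicit Types v w x : nat -> R.

(** Undoes one stage on absolute values: after the stage, [X] is the sum of the earlier coordinates
    and [S] the new one. *)
Lemma fold_solve (e X S : R) : 0 < e <= 4^-1 -> 0 <= X -> 0 <= S -> X + S <= 1 ->
  exists a, [/\ 0 <= a <= 1, X / (1 - e * a) <= 1 &
    a * (e + (1 - e) * (1 - X / (1 - e * a))) = S].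
Proof.
move=> /andP[e0 e4] X0 S0 XS.
(* [m] is the largest [a <= 1] with [X / (1 - e a) <= 1]. The polynomial [p] is the equation
   multiplied by [1 - e a]; it is [- S] at 0 and a nonnegative multiple of [1 - X - S] at [m]. *)
pose m := Num.min 1 ((1 - X) / e).
have m0 : 0 <= m by rewrite le_min ler01 divr_ge0 //; lra.
have m1 : m <= 1 by rewrite ge_min lexx.
have mX : e * m <= 1 - X by rewrite mulrC -ler_pdivlMr // ge_min lexx orbT.
pose p : {poly R} := 'X * (1 - e *: 'X) - ((1 - e) * X) *: 'X - S *: (1 - e *: 'X).
have pE a : p.[a] = a * (1 - e * a) - (1 - e) * X * a - S * (1 - e * a).
  by rewrite /p !hornerE.
have [||a] := @poly_ivt R p 0 m => //.
  rewrite !pE; apply/andP; split; first by lra.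
  have [me|me] := leP 1 ((1 - X) / e).
    have -> : m = 1 by rewrite /m min_l.
    nra.
  have -> : m = (1 - X) / e by rewrite /m min_r // ltW.
  have -> : e * ((1 - X) / e) = 1 - X by field; lra.
  have : 0 <= (1 - X) / e by rewrite divr_ge0 //; lra.
  have : e * ((1 - X) / e) = 1 - X by field; lra.
  set y := (1 - X) / e => ye y0.
  have -> : y * (1 - (1 - X)) - (1 - e) * X * y - S * (1 - (1 - X)) = X * (e * y) - S * X by ring.
  rewrite ye; nra.
move=> /andP[a0 am] /rootP; rewrite pE => Ha.
have ea : 0 < 1 - e * a by nra.
exists a; split; first by lra.
  by rewrite ler_pdivrMr // mul1r; nra.
have -> : a * (e + (1 - e) * (1 - X / (1 - e * a))) =
  (a * (1 - e * a) - (1 - e) * X * a) / (1 - e * a) by field; lra.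
by apply: (mulIf (lt0r_neq0 ea)); rewrite divfK ?lt0r_neq0 //; lra.
Qed.

Lemma shr_eq1 v n : in_cube v -> (forall i, (n <= i)%N -> v i = 0) -> shr v n = 1.
Proof.
move=> v1 v0; rewrite /shr (@pinf_fin _ _ _ 0); first by rewrite /pprod big_ord0.
  by move=> k; exact: shr_fact01.
by move=> k _; rewrite v0 ?leq_addr // normr0 mulr0 subr0.
Qed.

(** The last stage is undone first: dividing the earlier coordinates by its shrink factor [t] leaves
    a problem with one coordinate fewer. *)
Lemma collapse_surj_fin n x : psum x n <= 1 -> exists v,
  [/\ in_cube v, forall i, (n <= i)%N -> v i = 0 &
      forall k, (k < n)%N -> collapse v k = x k].
Proof.
elim: n x => [|n IH] x xn.
  by exists (fun=> 0); split => // k; rewrite normr0.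
rewrite psumS in xn.
have e4 : 0 < (eps n : R) <= 4^-1 by rewrite eps_gt0 eps_le4.
have [a [/andP[a0 a1] Xa aS]] := fold_solve e4 (psum_ge0 x n) (normr_ge0 (x n)) xn.
set t := 1 - eps n * a in Xa aS.
have t0 : 0 < t by rewrite /t; nra.
have pt : psum (fun i => x i / t) n = psum x n / t.
  rewrite /psum mulr_suml; apply: eq_bigr => i _.
  by rewrite normrM [`|t^-1|]ger0_norm // invr_ge0 ltW.
have [|v' [v'1 v'0 v'x]] := IH (fun i => x i / t); first by rewrite pt.
pose v i := if (i < n)%N then v' i else if i == n then Num.sg (x n) * a else 0.
have vn : v n = Num.sg (x n) * a by rewrite /v ltnn eqxx.
have vlt i : (i < n)%N -> v i = v' i by rewrite /v => ->.
have vgt i : (n < i)%N -> v i = 0.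
  by rewrite /v => ni; rewrite ltnNge (ltnW ni) /= gtn_eqF.
have v1 : in_cube v.
  move=> i; rewrite /v; case: ifP => _ //; case: ifP => _; last by rewrite normr0.
  rewrite normrM (ger0_norm a0); apply: mulr_ile1 => //.
  by rewrite normr_sg; case: (_ != _).
have Xt : 0 <= psum x n / t by rewrite divr_ge0 ?psum_ge0 // ltW.
(* The sign of 0 is 0, so [x n = 0] requires [a = 0]; the other factor in [aS] is positive. *)
have vna : `|v n| = a.
  rewrite vn normrM normr_sg (ger0_norm a0); have [xn0|_] := eqVneq (x n) 0; last exact: mul1r.
  rewrite mul0r; move: aS; rewrite xn0 normr0 => /eqP; rewrite mulf_eq0 => /orP[/eqP->//|/eqP].
  by nra.
have sv j : (j <= n)%N -> shr v j = shr v' j * t.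
  move=> /subKn <-; elim: (n - j)%N (leq_subr j n) => [_|d IHd dn].
    rewrite subn0 shrS // vna !shr_eq1 ?mul1r ?mulr1 //.
  have dE : (n - d = (n - d.+1).+1)%N by lia.
  rewrite shrS // -dE IHd ?(ltnW dn) // (@shrS _ v' v'1 (n - d.+1)) -dE vlt ?mulrA //; lia.
have rv j : (j <= n)%N -> stick v j = stick v' j.
  by move=> jn; apply: eq_bigr => i _; rewrite vlt // (leq_trans (ltn_ord i)).
have st' : stick v' n = 1 - psum x n / t.
  have := psum_collapse v'1 n; rewrite (shr_eq1 v'1 v'0) mulr1.
  rewrite -pt => H; rewrite -[stick v' n](subKr 1) -H; congr (1 - _).
  by apply: eq_bigr => i _; rewrite v'x.
exists v; split => // k; rewrite ltnS leq_eqVlt => /orP[/eqP->|kn].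
  rewrite /collapse (@shr_eq1 v) // mulr1 rv // st' vn -mulrA aS.
  by rewrite -numEsg.
rewrite /collapse sv // rv 1?ltnW // vlt // mulrA -/(collapse v' k) v'x //.
by rewrite divfK // gt_eqF.
Qed.

Lemma collapse_continuous k :
  continuous (fun v : cube R nat => collapse (crd v) k : R).
Proof.
have cn i : continuous (fun v : cube R nat => `|crd v i|).
  by apply: continuous_normr; exact: crd_continuous.
apply: continuous_mul; first apply: continuous_mul; first exact: crd_continuous.
  apply: continuous_add; first exact: continuous_cst.
  apply: continuous_mul; first exact: continuous_cst.
  rewrite /stick /pprod.
  apply: (@continuous_big R _ _ _ _ mul_continuous) => i _.
  by apply: continuous_sub; [exact: continuous_cst|exact: cn].
apply: (@pinf_continuous _ _ _ (fun n => 2 * eps (k.+1 + n))) => //.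
- by move=> n v; apply: shr_fact01 => i; exact: crd_norm.
- move=> n; apply: continuous_sub; first exact: continuous_cst.
  by apply: continuous_mul; [exact: continuous_cst|exact: cn].
- move=> v n m; have := @shr_sum _ (crd v) (fun i => crd_norm v i) (k.+1 + n) m.
  by under eq_bigr do rewrite -addnA.
- rewrite (_ : (fun n => _) = fun n => (fun m => 2 * eps m) (n + k.+1)%N).
    by have H := @eps_cvg0 R; rewrite -(cvg_shiftn k.+1) in H; exact: H.
  by apply/funext => n; rewrite addnC.
Qed.

Definition collapse_ball (v : cube R nat) : l1_ball R nat :=
  ball_of (collapse_l1le1 (fun i => crd_norm v i)).

Lemma collapse_homeo : exists (f : cube R nat -> l1_ball R nat) g,
  [/\ cancel f g, cancel g f, continuous f, continuous g &
      forall z : cube R nat, phi (bcrd (f z)) = pinf (fun i => 1 - `|crd z i|)].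
Proof.
have cc : continuous collapse_ball.
  apply: continuous_l1_ball => k.
  rewrite (_ : (fun z : cube R nat => _) = fun z : cube R nat => collapse (crd z) k); first exact: collapse_continuous.
  by apply/funext => v; rewrite ball_ofK.
have [g [fg gf cg]] : exists g, [/\ cancel collapse_ball g, cancel g collapse_ball & continuous g].
  apply: (compact_bij_homeo _ _ cc); [exact: cube_compact|exact: l1_ball_hausdorff| |].
    move=> v w vw; apply: crd_inj; apply: collapse_inj => [i|i|i]; try exact: crd_norm.
    by have := congr1 (fun z => bcrd z i) vw; rewrite !ball_ofK.
  move=> y.
  have [v vP] := choice (fun n => collapse_surj_fin (bcrd_le1 y n)).
  apply: (@approx_surj _ _ collapse_ball y (fun n => cube_of (v n))) => //.
  - exact: cube_compact.
  - exact: l1_ball_hausdorff.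
  apply: (cvg_l1_ball (x := fun n => collapse_ball (cube_of (v n)))) => k.
  apply: cvg_near_cst; exists k.+1 => // n /= kn.
  have [v1 v0 vy] := vP n; rewrite ball_ofK -vy //.
  by congr collapse; apply/funext => i; rewrite cube_ofK.
exists collapse_ball, g; split => // v.
rewrite -phi_collapse; last by move=> i; exact: crd_norm.
by apply: eq_phi => n; rewrite ball_ofK.
Qed.

End collapsing_homeo.

(** * Freeing one coordinate *)

Section stage.
Context {R : realFieldType}.
Implicit Types r e x s E t l q f : R.

(* One stage of (b), where [r] is the room left to the coordinates to come and
   [e], [E] are the rescaled depths of [x_0].  It maps
   [{(e, x) | |x| <= min r e}] onto [{(E, s) | |s| <= r}] and preserves the room
   left afterwards, [t = min r e - |x| = min (r - |s|) (4 E)].  With [l = r - t],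
   the level curve of [t] is parametrized on the left by the signed position
   [q = +- (e - t)], and on the right by [(s, f)], [f = E - t / 4], where [f = 0]
   or [|s| = l].  The end [f = 0] of the right curve is the image of
   [l / 2 <= q <= 3 l / 2] and not of an interval around the tip [q = 0].  A map
   commuting with [x |-> - x] would preserve the points with [x_k = 0] for all
   [k > 0], on which [phi] is [1 - |x_0|] before and [1] after all stages. *)
Definition fwd_s l q := Num.max (- l) (Num.min l (2 * (q - l))).
Definition fwd_f t l q :=
  Num.max 0 (Num.min (q + 3 / 4 * t) (2 * q - 3 * l)) +
  Num.max 0 (Num.max (l / 4 - q / 2) (Num.min (- 2 * q) (3 / 4 * t - q))).
Definition bwd t l s f :=
  if 0 <= s then Num.max (l + s / 2 + f / 2) (f - 3 / 4 * t)
  else Num.max (l + s / 2 - 2 * f) (Num.min (- f / 2) (3 / 4 * t - f)).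

Lemma fwd_top t l q : 0 <= t -> 0 <= l -> 3 / 2 * l <= q ->
  fwd_s l q = l /\ fwd_f t l q = Num.min (q + 3 / 4 * t) (2 * q - 3 * l).
Proof.
move=> t0 l0 ql; rewrite /fwd_s /fwd_f; split.
  by rewrite min_l ?max_r //; lra.
rewrite [X in X + _]max_r; last by rewrite le_min; apply/andP; split; lra.
rewrite max_l ?addr0 // ge_max ge_min; apply/andP; split; first lra.
by apply/orP; left; lra.
Qed.

Lemma fwd_mid t l q : 0 <= t -> l / 2 <= q <= 3 / 2 * l ->
  fwd_s l q = 2 * (q - l) /\ fwd_f t l q = 0.
Proof.
move=> t0 /andP[q1 q2]; rewrite /fwd_s /fwd_f; split.
  by rewrite min_r ?max_r //; lra.
rewrite [X in X + _]max_l; last by rewrite ge_min; apply/orP; right; lra.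
rewrite max_l ?addr0 // ge_max ge_min; apply/andP; split; first lra.
by apply/orP; left; lra.
Qed.

Lemma fwd_bot t l q : 0 <= t -> 0 <= l -> q <= l / 2 ->
  fwd_s l q = - l /\
  fwd_f t l q = Num.max (l / 4 - q / 2) (Num.min (- 2 * q) (3 / 4 * t - q)).
Proof.
move=> t0 l0 ql; rewrite /fwd_s /fwd_f; split.
  by rewrite max_l // ge_min; apply/orP; right; lra.
rewrite [X in X + _]max_l; last by rewrite ge_min; apply/orP; right; lra.
by rewrite max_r ?add0r // le_max; apply/orP; left; lra.
Qed.

Lemma fwd_bounds t l q : 0 <= t -> 0 <= l ->
  [/\ `|fwd_s l q| <= l, 0 <= fwd_f t l q & fwd_f t l q = 0 \/ `|fwd_s l q| = l].
Proof.
move=> t0 l0; have [ql|ql] := leP (3 / 2 * l) q.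
  have [-> ->] := fwd_top t0 l0 ql; rewrite ger0_norm //; split => //; last by right.
  by rewrite le_min; apply/andP; split; lra.
have [ql'|ql'] := leP (l / 2) q.
  have [|-> ->] := @fwd_mid t l q t0; first lra.
  by rewrite ler_norml lexx; split; [lra| |left].
have [-> ->] := fwd_bot t0 l0 (ltW ql').
rewrite normrN ger0_norm //; split => //; last by right.
by rewrite le_max; apply/orP; left; lra.
Qed.

(** For [l = 0] the point [x] is 0 and has no sign, so the two positions [q] and [- q] must have the
    same image. *)
Lemma fwd_even t q : 0 <= t -> fwd_f t 0 (- q) = fwd_f t 0 q /\ fwd_s 0 (- q) = fwd_s 0 q.
Proof.
move=> t0; wlog q0 : q / 0 <= q => [H|].
  have [/H //|q0] := leP 0 q; have := H (- q); rewrite opprK => -[|-> ->//]; lra.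
have [|-> ->] := @fwd_top t 0 q t0 (lexx 0); first lra.
have [|-> ->] := @fwd_bot t 0 (- q) t0 (lexx 0); first lra.
rewrite oppr0; split => //; rewrite max_r.
  by rewrite minC; congr (Num.min _ _); lra.
by rewrite le_min; apply/andP; split; lra.
Qed.

Lemma bwdK t l q : 0 <= t -> 0 <= l ->
  `|bwd t l (fwd_s l q) (fwd_f t l q)| = `|q| /\
  (l = 0 \/ bwd t l (fwd_s l q) (fwd_f t l q) = q).
Proof.
move=> t0 l0; have top q' : 3 / 2 * l <= q' -> bwd t l (fwd_s l q') (fwd_f t l q') = q'.
  move=> ql; have [-> ->] := fwd_top t0 l0 ql; rewrite /bwd l0.
  have [H|H] := leP (q' + 3 / 4 * t) (2 * q' - 3 * l); first by rewrite max_r; lra.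
  by rewrite max_l; lra.
have [ql|ql] := leP (3 / 2 * l) q; first by rewrite top //; split => //; right.
have [ql'|ql'] := leP (l / 2) q.
  have [|-> ->] := @fwd_mid t l q t0; first lra.
  rewrite /bwd; suff -> : (if 0 <= 2 * (q - l)
    then Num.max (l + 2 * (q - l) / 2 + 0 / 2) (0 - 3 / 4 * t)
    else Num.max (l + 2 * (q - l) / 2 - 2 * 0) (Num.min (- 0 / 2) (3 / 4 * t - 0))) = q.
    by split => //; right.
  case: ifP => _; first by rewrite max_l; lra.
  by rewrite max_l; [lra|rewrite ge_min; apply/orP; left; lra].
(* For [l = 0] and [q < 0] the image has [s = 0], so [bwd] takes its first branch and returns
   [- q]. *)
have [l00|l00] := eqVneq l 0.
  split; last by left.
  have := top (- q); rewrite l00 in ql ql' *; have [-> ->] := fwd_even q t0.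
  by move=> -> //; [rewrite normrN|lra].
have l1 : 0 < l by rewrite lt_def l00.
have [-> ->] := fwd_bot t0 l0 (ltW ql').
rewrite /bwd leNgt oppr_lt0 l1 /=.
set m := Num.max (l / 4 - q / 2) _.
suff -> : Num.max (l + - l / 2 - 2 * m) (Num.min (- m / 2) (3 / 4 * t - m)) = q.
  by split => //; right.
rewrite /m; have [H1|H1] := leP (- 2 * q) (3 / 4 * t - q).
  have [H2|H2] := leP (l / 4 - q / 2) (- 2 * q).
    by rewrite [Num.min _ _]min_l; [rewrite max_r; lra|lra].
  rewrite max_l; first lra.
  by rewrite ge_min; apply/orP; left; lra.
have [H2|H2] := leP (l / 4 - q / 2) (3 / 4 * t - q).
  by rewrite [Num.min _ _]min_r; [rewrite max_r; lra|lra].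
rewrite max_l; first lra.
by rewrite ge_min; apply/orP; right; lra.
Qed.

Lemma fwdK t l s f : 0 <= t -> `|s| <= l -> 0 <= f -> f = 0 \/ `|s| = l ->
  fwd_s l (bwd t l s f) = s /\ fwd_f t l (bwd t l s f) = f.
Proof.
rewrite ler_norml => t0 /andP[s1 s2] f0 fs.
have l0 : 0 <= l by lra.
rewrite /bwd; have [s0|s0] := leP 0 s.
  have [->|sl] := fs.
    rewrite max_l; last lra.
    by have [|-> ->] := @fwd_mid t l (l + s / 2 + 0 / 2) t0; [lra|split; lra].
  rewrite ger0_norm // in sl; set m := Num.max _ _.
  have [|-> ->] := @fwd_top t l m t0 l0; first by rewrite le_max; apply/orP; left; lra.
  split; first by rewrite sl.
  rewrite /m sl; have [H|H] := leP (l + l / 2 + f / 2) (f - 3 / 4 * t).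
    by rewrite min_l; lra.
  by rewrite min_r; lra.
have [->|sl] := fs.
  rewrite max_l; last by rewrite ge_min; apply/orP; left; lra.
  by have [|-> ->] := @fwd_mid t l (l + s / 2 - 2 * 0) t0; [lra|split; lra].
rewrite ltr0_norm // in sl; set m := Num.max _ _.
have [|-> ->] := @fwd_bot t l m t0 l0.
  rewrite ge_max ge_min; apply/andP; split; first lra.
  by apply/orP; left; lra.
split; first lra.
rewrite /m -sl; have [H1|H1] := leP (- f / 2) (3 / 4 * t - f).
  have [H2|H2] := leP (- s + s / 2 - 2 * f) (- f / 2).
    by rewrite [Num.min _ _]min_l; [rewrite max_r; lra|lra].
  rewrite max_l; first lra.
  by rewrite ge_min; apply/orP; left; lra.
have [H2|H2] := leP (- s + s / 2 - 2 * f) (3 / 4 * t - f).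
  by rewrite [Num.min _ _]min_r; [rewrite max_r; lra|lra].
rewrite max_l; first lra.
by rewrite ge_min; apply/orP; right; lra.
Qed.

(** With [|q| = e - t] and [l = r - t] this says [r - |s| <= e], the bound used for the squeeze in
    [phi_run]. *)
Lemma fwd_ge t l q : 0 <= t -> 0 <= l -> l - `|fwd_s l q| <= `|q|.
Proof.
move=> t0 l0; have [ql|ql] := leP (3 / 2 * l) q.
  by have [-> _] := fwd_top t0 l0 ql; rewrite ger0_norm // subrr.
have [ql'|ql'] := leP (l / 2) q; last first.
  by have [-> _] := fwd_bot t0 l0 (ltW ql'); rewrite normrN ger0_norm // subrr.
have [|-> _] := @fwd_mid t l q t0; first lra.
rewrite [`|q|]ger0_norm; last lra.
by have := ler_norm (2 * (q - l)); have := ler_norm (- (2 * (q - l))); rewrite normrN; lra.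
Qed.

(** Gives [E = e] once [e >= 3 r]. A stage thus moves only points of small depth, and by at most
    [3 r], which makes the depths converge. *)
Lemma fwd_far t l q : 0 <= t -> 0 <= l -> 3 * (t + l) <= t + `|q| ->
  fwd_f t l q = `|q| + 3 / 4 * t.
Proof.
move=> t0 l0; have [q0|q0] := leP 0 q.
  rewrite ger0_norm // => H; have [|_ ->] := @fwd_top t l q t0 l0; first lra.
  by rewrite min_l //; lra.
rewrite ltr0_norm // => H; have [|_ ->] := @fwd_bot t l q t0 l0; first lra.
by rewrite [Num.min _ _]min_r; [rewrite max_r; lra|lra].
Qed.

Lemma fwd_near t l q : 0 <= t -> 0 <= l -> t + `|q| < 3 * (t + l) ->
  t / 4 + fwd_f t l q < 3 * (t + l).
Proof.
move=> t0 l0 H; have [ql|ql] := leP (3 / 2 * l) q.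
  have [_ ->] := fwd_top t0 l0 ql; have := ler_norm q.
  have : Num.min (q + 3 / 4 * t) (2 * q - 3 * l) <= q + 3 / 4 * t by rewrite ge_min lexx.
  lra.
have [ql'|ql'] := leP (l / 2) q.
  have [|_ ->] := @fwd_mid t l q t0; first lra.
  by have := normr_ge0 q; lra.
have [_ ->] := fwd_bot t0 l0 (ltW ql').
have q1 := ler_norm (- q); rewrite normrN in q1; have q2 := normr_ge0 q.
rewrite -ltrBrDl gt_max gt_min; apply/andP; split; first lra.
by apply/orP; right; lra.
Qed.

(* [lvl] is [t] and [pos] is [q] in the notation above. *)
Definition lvl r e x := Num.min r e - `|x|.
Definition pos r e x := if 0 <= x then e - lvl r e x else lvl r e x - e.
Definition xi_s r e x := fwd_s (r - lvl r e x) (pos r e x).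
Definition xi_e r e x :=
  lvl r e x / 4 + fwd_f (lvl r e x) (r - lvl r e x) (pos r e x).

(** The inverse stage. As [|x| = min l |q|], the coordinate [x] is the position [q] truncated to
    [[- l, l]]. *)
Definition ga_t r E s := Num.min (4 * E) (r - `|s|).
Definition ga_q r E s := bwd (ga_t r E s) (r - ga_t r E s) s (E - ga_t r E s / 4).
Definition ga_e r E s := ga_t r E s + `|ga_q r E s|.
Definition ga_x r E s :=
  Num.max (- (r - ga_t r E s)) (Num.min (r - ga_t r E s) (ga_q r E s)).

Section forward.
Variables r e x : R.
Hypotheses (xr : `|x| <= r) (xe : `|x| <= e).
Let t := lvl r e x.

Let t0 : 0 <= t.
Proof. by rewrite subr_ge0 le_min xr. Qed.

Let tr : t <= r - `|x|.
Proof. by rewrite lerD2r ge_min lexx. Qed.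

Let te : t <= e - `|x|.
Proof. by rewrite lerD2r ge_min lexx orbT. Qed.

Let tl : 0 <= r - t.
Proof. by have := normr_ge0 x; move: tr; lra. Qed.

Let posE : `|pos r e x| = e - t.
Proof.
have := normr_ge0 x; rewrite /pos -/t => x0.
by case: ifP => _; [|rewrite -normrN opprB]; rewrite ger0_norm //; move: te; lra.
Qed.

Let xE : `|x| = Num.min (r - t) (e - t).
Proof.
rewrite /t /lvl; have [re|re] := leP r e.
  by rewrite min_l ?lerD2r // subKr.
by rewrite min_r ?lerD2r ?ltW // subKr.
Qed.

Lemma xi_s_le : `|xi_s r e x| <= r.
Proof.
have [+ _ _] := fwd_bounds (pos r e x) t0 tl; move/le_trans; apply.
by move: t0; lra.
Qed.

Lemma xi_e_ge0 : 0 <= xi_e r e x.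
Proof.
have [_ f0 _] := fwd_bounds (pos r e x) t0 tl; rewrite /xi_e -/t.
by move: t0; lra.
Qed.

Lemma xi_lvl : Num.min (r - `|xi_s r e x|) (4 * xi_e r e x) = t.
Proof.
have [sl f0] := fwd_bounds (pos r e x) t0 tl; rewrite /xi_e /xi_s -/t => -[->|->].
  by rewrite min_r; lra.
by rewrite min_l; lra.
Qed.

Lemma xi_e_lower : r - `|xi_s r e x| <= e.
Proof. by have := fwd_ge (pos r e x) t0 tl; rewrite posE /xi_s -/t; lra. Qed.

Lemma xi_far : 3 * r <= e -> xi_e r e x = e.
Proof.
move=> re; have := @fwd_far t (r - t) (pos r e x) t0 tl; rewrite posE /xi_e -/t.
by move=> ->; lra.
Qed.

Lemma xi_near : e < 3 * r -> xi_e r e x < 3 * r.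
Proof.
move=> re; have := @fwd_near t (r - t) (pos r e x) t0 tl; rewrite posE /xi_e -/t.
by move/(_ _)/lt_le_trans => -> //; lra.
Qed.

Lemma xi_move : `|xi_e r e x - e| <= 3 * r.
Proof.
have r0 : 0 <= r by exact: le_trans xr.
have e0 : 0 <= e by exact: le_trans xe.
have [re|re] := leP (3 * r) e; first by rewrite xi_far // subrr normr0; lra.
by have := xi_near re; have := xi_e_ge0; rewrite ler_norml; lra.
Qed.

Lemma ga_xi : ga_e r (xi_e r e x) (xi_s r e x) = e /\
  ga_x r (xi_e r e x) (xi_s r e x) = x.
Proof.
rewrite /ga_e /ga_x /ga_q /ga_t minC xi_lvl.
have -> : xi_e r e x - t / 4 = fwd_f t (r - t) (pos r e x) by rewrite addrC addKr.
have [qE qK] := bwdK (pos r e x) t0 tl; rewrite qE posE; split; first lra.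
have x_pos : Num.max (- (r - t)) (Num.min (r - t) (pos r e x)) = x.
  rewrite /pos -/t; have [x0|x0] := leP 0 x.
    by rewrite -xE ger0_norm // max_r //; move: tr; rewrite ger0_norm //; lra.
  have xN : x = - `|x| by rewrite ltr0_norm // opprK.
  rewrite [RHS]xN xE oppr_min (opprB e).
  by rewrite [Num.min _ _]min_r //; move: te; have := normr_ge0 x; move: tl; lra.
(* For [l = 0] only [|q|] is recovered, but then [x = 0]. *)
have [l0|->] := qK; last exact: x_pos.
have x0 : x = 0 by apply/eqP; rewrite -normr_le0; move: tr l0; lra.
rewrite x0 l0 oppr0; apply/le_anti; rewrite le_max lexx andbT.
by rewrite ge_max lexx ge_min lexx.
Qed.

End forward.

Lemma xi_ga r E s : `|s| <= r -> 0 <= E ->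
  [/\ `|ga_x r E s| <= r, `|ga_x r E s| <= ga_e r E s,
      xi_s r (ga_e r E s) (ga_x r E s) = s & xi_e r (ga_e r E s) (ga_x r E s) = E].
Proof.
move=> sr E0; rewrite /ga_e /ga_x; set t := ga_t r E s; set q := ga_q r E s.
have t0 : 0 <= t by rewrite /t /ga_t le_min; apply/andP; split; lra.
have ts : t <= r - `|s| by rewrite ge_min lexx orbT.
have tE : t <= 4 * E by rewrite ge_min lexx.
have l0 : 0 <= r - t by have := normr_ge0 s; lra.
have sl : `|s| <= r - t by lra.
have f0 : 0 <= E - t / 4 by lra.
have fs : E - t / 4 = 0 \/ `|s| = r - t.
  by rewrite /t /ga_t; have [_|_] := leP (4 * E) (r - `|s|); [left; lra|right; lra].
have [Ks Kf] := fwdK t0 sl f0 fs; rewrite -/(ga_q r E s) -/q in Ks Kf.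
set x := Num.max _ _.
have xE : `|x| = Num.min (r - t) `|q|.
  rewrite /x; have [q0|q0] := leP 0 q.
    by rewrite max_r ?ger0_norm // ?le_min ?l0 //; lra.
  rewrite [Num.min _ q]min_r; last lra.
  rewrite [in RHS]ltr0_norm // -{2}(opprK (r - t)) -oppr_max ler0_norm //.
  by rewrite ge_max; apply/andP; split; lra.
have lE : lvl r (t + `|q|) x = t.
  rewrite /lvl xE; have [H|H] := leP (r - t) `|q|; first by rewrite min_l; lra.
  by rewrite min_r; lra.
have xl : `|x| <= r - t /\ `|x| <= `|q| by rewrite xE !ge_min !lexx orbT.
(* The sign of [q] is lost only if [q < 0] is truncated to [x = 0], that is for [l = 0]; [fwd_even]
   covers this case. *)
have pE : pos r (t + `|q|) x = q \/ r - t = 0 /\ pos r (t + `|q|) x = - q.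
  rewrite /pos lE; have [q0|q0] := leP 0 q.
    left; rewrite ger0_norm // ifT; first lra.
    by rewrite /x le_max le_min l0 q0 orbT.
  rewrite ltr0_norm //; case: ifP => x0; last by left; lra.
  right; split; last lra.
  move: x0; rewrite /x le_max le_min (leNgt 0 q) q0 andbF orbF; lra.
rewrite /xi_s /xi_e lE; have [xl1 xl2] := xl.
split; first lra.
- lra.
- by case: pE => [->//|[l00 ->]]; move: Ks; rewrite l00; have [_ ->] := fwd_even q t0.
- case: pE => [->|[l00 ->]]; first lra.
  by move: Kf; rewrite l00; have [-> _] := fwd_even q t0; lra.
Qed.

Lemma maxr_lip (a b a' b' c : R) : `|a - a'| <= c -> `|b - b'| <= c ->
  `|Num.max a b - Num.max a' b'| <= c.
Proof.
rewrite !ler_norml => /andP[? ?] /andP[? ?].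
by have [?|?] := leP a b; have [?|?] := leP a' b'; apply/andP; split; lra.
Qed.

Lemma minr_lip (a b a' b' c : R) : `|a - a'| <= c -> `|b - b'| <= c ->
  `|Num.min a b - Num.min a' b'| <= c.
Proof.
rewrite !ler_norml => /andP[? ?] /andP[? ?].
by have [?|?] := leP a b; have [?|?] := leP a' b'; apply/andP; split; lra.
Qed.

(** Taking the positive part of [E - (r - |s|) / 4] merges the two cases of [ga_t]; what remains is
    built by max, min and modulus from terms of slope at most 2 in [E]. *)
Lemma ga_eE r E s : `|s| <= r -> 0 <= E ->
  let f := Num.max 0 (E - (r - `|s|) / 4) in
  ga_e r E s = if 0 <= s then Num.max (r + s / 2 + f / 2) E
    else (r + s) + `|Num.max (- s / 2 - 2 * f) (Num.min (- f / 2) (r + s - E))|.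
Proof.
move=> sr E0 f; rewrite /ga_e /ga_q /bwd.
have sr' : - r <= s <= r by rewrite -ler_norml.
have [Es|Es] := leP (4 * E) (r - `|s|).
  have -> : f = 0 by rewrite /f max_l //; lra.
  rewrite /ga_t min_l //; have [s0|s0] := leP 0 s.
    by rewrite ger0_norm // in Es; rewrite !max_l ?ger0_norm; lra.
  rewrite ltr0_norm // in Es.
  rewrite !max_l; [|rewrite ge_min; apply/orP; left; lra..].
  by rewrite !ger0_norm; lra.
have -> : f = E - (r - `|s|) / 4 by rewrite /f max_r //; lra.
rewrite /ga_t min_r; last exact: ltW.
have [s0|s0] := leP 0 s.
  rewrite ger0_norm // in Es *.
  rewrite ger0_norm; last by rewrite le_max; apply/orP; left; lra.
  rewrite addr_maxr; congr (Num.max _ _); lra.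
rewrite ltr0_norm // in Es *.
congr (_ + `|Num.max _ (Num.min _ _)|); lra.
Qed.

(** The constant 2 matters: it is beaten by the rate [4^-n] at which the depths converge, see
    [process_inj]. *)
Lemma ga_lip r E E' s : `|s| <= r -> 0 <= E -> 0 <= E' ->
  `|ga_e r E s - ga_e r E' s| <= 2 * `|E - E'|.
Proof.
move=> sr E0 E'0; rewrite !ga_eE //.
set f := Num.max 0 (E - _); set f' := Num.max 0 (E' - _).
have ff : `|f - f'| <= `|E - E'|.
  apply: maxr_lip; first by rewrite subrr normr0.
  by rewrite opprB addrA addrNK.
have EE := normr_ge0 (E - E').
case: ifP => _.
  apply: maxr_lip; last lra.
  have -> : r + s / 2 + f / 2 - (r + s / 2 + f' / 2) = (f - f') / 2 by lra.
  by rewrite normrM [`|2^-1|]ger0_norm ?invr_ge0 //; lra.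
rewrite opprD addrACA subrr add0r; apply: le_trans (ler_dist_dist _ _) _.
apply: maxr_lip.
  have -> : - s / 2 - 2 * f - (- s / 2 - 2 * f') = 2 * (f' - f) by lra.
  by rewrite normrM distrC [`|2|]ger0_norm //; lra.
apply: minr_lip.
  have -> : - f / 2 - - f' / 2 = (f' - f) / 2 by lra.
  by rewrite normrM [`|2^-1|]ger0_norm ?invr_ge0 // distrC; lra.
have -> : r + s - E - (r + s - E') = E' - E by lra.
by rewrite distrC; lra.
Qed.

End stage.

(** * Iteration of the stages *)

Section process.
Context {R : realType}.
Implicit Types x s : nat -> R.

Definition scale4 k : R := 4 ^+ k.+1.

Lemma scale4_ge4 k : 4 <= scale4 k.
Proof. by rewrite /scale4 exprS ler_peMr // exprn_ege1 // ler1n. Qed.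

Lemma scale4_gt0 k : 0 < scale4 k.
Proof. by have := scale4_ge4 k; lra. Qed.

Lemma scale4S k : scale4 k.+1 = 4 * scale4 k.
Proof. exact: exprS. Qed.

(* State after [k] stages: the room [1 - \sum_(i < k) |s_i|] and the depth. *)
Fixpoint rD (D0 : R) x k : R * R :=
  if k is k'.+1 then
    let: (r, D) := rD D0 x k' in
    (r - `|xi_s r (scale4 k' * D) (x k')|, xi_e r (scale4 k' * D) (x k') / scale4 k')
  else (1, D0).
Definition room (D0 : R) x k := (rD D0 x k).1.
Definition depth (D0 : R) x k := (rD D0 x k).2.
Definition out (D0 : R) x k := xi_s (room D0 x k) (scale4 k * depth D0 x k) (x k).
Definition depth_lim (D0 : R) x := lim (depth D0 x @ \oo).

Lemma roomS (D0 : R) x k : room D0 x k.+1 = room D0 x k - `|out D0 x k|.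
Proof. by rewrite /out /room /depth /=; case: (rD D0 x k). Qed.

Lemma depthS (D0 : R) x k : depth D0 x k.+1 =
  xi_e (room D0 x k) (scale4 k * depth D0 x k) (x k) / scale4 k.
Proof. by rewrite /room /depth /=; case: (rD D0 x k). Qed.

Lemma roomE (D0 : R) x k : room D0 x k = 1 - psum (out D0 x) k.
Proof.
elim: k => [|k IH]; first by rewrite psum0 subr0.
by rewrite roomS IH psumS opprD addrA.
Qed.

Definition feasible (D0 : R) x := 0 <= D0 <= 1 /\ forall n, psum x n <= Num.min 1 (4 * D0).

Section run.
Variables (D0 : R) (x : nat -> R).
Hypothesis feas : feasible D0 x.
Let D01 := feas.1.
Let x1 := feas.2.
Let r := room D0 x.
Let D := depth D0 x.
Let s := out D0 x.
Let N := scale4.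

(** A stage preserves the level [min r e - |x_k|], and as [scale4 k.+1 = 4 * scale4 k] this level is
    the bound [min r e] of the next stage. So each coordinate is deducted once from the initial
    bound [min 1 (4 D0)]. *)
Lemma process_inv k : [/\ 0 <= r k <= 1, `|x k| <= r k, `|x k| <= N k * D k &
  Num.min (r k) (N k * D k) = Num.min 1 (4 * D0) - psum x k].
Proof.
have dom k' : Num.min (r k') (N k' * D k') = Num.min 1 (4 * D0) - psum x k' ->
    `|x k'| <= r k' /\ `|x k'| <= N k' * D k'.
  by move=> H; apply/andP; rewrite -le_min H; have := x1 k'.+1; rewrite psumS; lra.
elim: k => [|k [/andP[r0 r1] xr xD lvlk]].
  have H0 : Num.min (r 0) (N 0 * D 0) = Num.min 1 (4 * D0) - psum x 0 by rewrite psum0 subr0.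
  by have [? ?] := dom _ H0; split => //; rewrite ler01 lexx.
have sr : `|s k| <= r k by exact: xi_s_le xr xD.
have HS : Num.min (r k.+1) (N k.+1 * D k.+1) = Num.min 1 (4 * D0) - psum x k.+1.
  rewrite /r /D /N roomS depthS scale4S -mulrA [scale4 k * _]mulrC divfK ?gt_eqF ?scale4_gt0 //.
  by rewrite (xi_lvl xr xD) /lvl lvlk psumS opprD addrA.
have [? ?] := dom _ HS; split => //; rewrite /r roomS -/r -/s.
by have := normr_ge0 (s k); lra.
Qed.

Lemma process_dom k : `|x k| <= r k /\ `|x k| <= N k * D k.
Proof. by have [_ ? ? _] := process_inv k. Qed.

Lemma out_le k : `|s k| <= r k.
Proof. by have [? ?] := process_dom k; exact: xi_s_le. Qed.

Lemma out_l1le1 : l1le1 s.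
Proof. by move=> n; have [+ _ _ _] := process_inv n; rewrite /r roomE -/s; lra. Qed.

Lemma depth_ge0 k : 0 <= D k.
Proof.
case: k => [|k]; first by case/andP: D01.
have [? ?] := process_dom k.
by rewrite /D depthS divr_ge0 ?xi_e_ge0 // ltW // scale4_gt0.
Qed.

Lemma depth_move k : `|D k.+1 - D k| <= 3 / N k.
Proof.
have [a b] := process_dom k; rewrite /D depthS.
rewrite -[X in _ - X](mulfK (lt0r_neq0 (scale4_gt0 k))) [X in _ - X / _]mulrC -mulrBl.
rewrite normrM [X in _ * X]ger0_norm ?invr_ge0 ?(ltW (scale4_gt0 k)) //.
apply: ler_wpM2r; first by rewrite invr_ge0 ltW // scale4_gt0.
apply: le_trans (xi_move a b) _; have [/andP[_ r1] _ _ _] := process_inv k.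
by rewrite -/r; lra.
Qed.

(** A stage keeps the depth or leaves it below [3 r / scale4 k <= 3 / 4]. Hence the limit can be 1
    only if [D0 = 1]. *)
Lemma depth_max k : D k <= Num.max D0 (3 / 4).
Proof.
elim: k => [|k IH]; first by rewrite le_max lexx.
have [a b] := process_dom k; have [/andP[_ r1] _ _ _] := process_inv k.
rewrite /D depthS; have [H|H] := leP (3 * r k) (N k * D k).
  by rewrite (xi_far a b H) mulrC mulKf // gt_eqF // scale4_gt0.
rewrite le_max; apply/orP; right; rewrite ler_pdivrMr ?scale4_gt0 //; apply/ltW.
by apply: lt_le_trans (xi_near a b H) _; have := @scale4_ge4 k; lra.
Qed.

Lemma depth_eq1 k : D0 = 1 -> D k = 1.
Proof.
move=> D1; elim: k => [//|k IH]; have [a b] := process_dom k.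
have [/andP[_ r1] _ _ _] := process_inv k.
have far : 3 * r k <= N k * D k by rewrite IH mulr1 /N; have := scale4_ge4 k; lra.
by rewrite /D depthS (xi_far a b far) -/D IH mulr1 divff // gt_eqF // scale4_gt0.
Qed.

Lemma depth_cauchy n m : `|D (n + m)%N - D n| <= 4^-1 ^+ n - 4^-1 ^+ (n + m).
Proof.
elim: m => [|m IH]; first by rewrite addn0 !subrr normr0.
rewrite addnS; apply: le_trans (ler_distD (D (n + m)%N) _ _) _.
apply: le_trans (lerD (depth_move (n + m)) IH) _.
(* As [N k = 4 ^ (k + 1)], the bounds [3 / N k] telescope. *)
have -> : 3 / N (n + m)%N = 4^-1 ^+ (n + m) - 4^-1 ^+ (n + m).+1.
  rewrite /N /scale4 -exprVn !exprS; lra.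
lra.
Qed.

Lemma quarter_cvg0 : (fun n => 4^-1 ^+ n) @ \oo --> (0 : R).
Proof. by apply: cvg_expr; rewrite gtr0_norm ?invr_gt0 // invf_lt1 // ltr1n. Qed.

Lemma depth_cvg : D @ \oo --> depth_lim D0 x.
Proof.
have : cvgn (fun n => D n + 4^-1 ^+ n).
  apply: nonincreasing_is_cvgn.
    apply/nonincreasing_seqP => n.
    have := depth_cauchy n 1; rewrite addn1 ler_norml; lra.
  by exists 0 => _ [n _ <-]; rewrite addr_ge0 ?exprn_ge0 ?depth_ge0.
move=> /cvg_ex[l ul]; apply: (cvgP (l - 0)).
have -> : D = fun n => (D n + 4^-1 ^+ n) - 4^-1 ^+ n.
  by apply/funext => n; rewrite addrK.
by apply: cvgB => //; exact: quarter_cvg0.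
Qed.

Lemma depth_lim_le n : `|D n - depth_lim D0 x| <= 4^-1 ^+ n.
Proof.
have : (fun m => `|D n - D (m + n)%N|) @ \oo --> `|D n - depth_lim D0 x|.
  apply: cvg_norm; apply: cvgB; first exact: cvg_cst.
  by rewrite (cvg_shiftn n D); exact: depth_cvg.
move=> /cvg_le_cst; apply => m; rewrite distrC addnC.
by apply: le_trans (depth_cauchy n m) _; rewrite gerBl exprn_ge0.
Qed.

Lemma ga_run k : D k = ga_e (r k) (N k * D k.+1) (s k) / N k /\
  x k = ga_x (r k) (N k * D k.+1) (s k).
Proof.
have [a b] := process_dom k; have [e1 e2] := ga_xi a b.
have -> : N k * D k.+1 = xi_e (r k) (N k * D k) (x k).
  by rewrite /D depthS mulrC divfK // gt_eqF // scale4_gt0.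
by rewrite e1 e2 mulrC mulKf // gt_eqF // scale4_gt0.
Qed.

(** The part of the initial bound not yet used at stage [k] lies between [r k.+1] and [r k], both of
    which tend to [phi s]. *)
Lemma phi_run : psum x @ \oo --> Num.min 1 (4 * D0) - phi s.
Proof.
have rphi : r @ \oo --> phi s.
  have -> : r = fun k => 1 - psum s k by apply/funext => k; exact: roomE.
  rewrite -[phi s](subKr 1); apply: cvgB; first exact: cvg_cst.
  by apply: phi_cvg; exact: out_l1le1.
have -> : psum x = fun k => Num.min 1 (4 * D0) - Num.min (r k) (N k * D k).
  by apply/funext => k; have [_ _ _ ->] := process_inv k; rewrite subKr.
apply: cvgB; first exact: cvg_cst.
have rS : (fun k => r k.+1) @ \oo --> phi s by rewrite (cvg_shiftS r).
apply: (squeeze_cvgr _ rS rphi).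
apply: nearW => k; rewrite ge_min lexx andbT le_min.
have [a b] := process_dom k; rewrite /r roomS -/r -/s; apply/andP; split.
  by rewrite gerBl.
exact: xi_e_lower.
Qed.

End run.

End process.

(** * Recovering the input of the process *)

Section process_bijective.
Context {R : realType}.

(** Equal outputs give equal rooms. Going back [m] stages multiplies a difference of depths by at
    most [2 ^ m], but after [m + k] stages this difference is at most [2 * 4 ^ (- (m + k))], the
    limits being equal; so it is 0. *)
Lemma process_inj (D0 D0' : R) (x x' : nat -> R) : feasible D0 x -> feasible D0' x' ->
  out D0 x =1 out D0' x' -> depth_lim D0 x = depth_lim D0' x' -> D0 = D0' /\ x =1 x'.
Proof.
move=> f f' soo ll; have rr k : room D0 x k = room D0' x' k.
  by rewrite !roomE; congr (1 - _); apply: eq_bigr => i _; rewrite soo.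
have step k : `|depth D0 x k - depth D0' x' k| <= 2 * `|depth D0 x k.+1 - depth D0' x' k.+1|.
  have [-> _] := ga_run f k; have [-> _] := ga_run f' k; rewrite -rr -soo -mulrBl.
  have N0 := @scale4_gt0 R k.
  rewrite normrM [`|_^-1|]ger0_norm ?invr_ge0 ?(ltW N0) // ler_pdivrMr //.
  apply: le_trans (ga_lip (out_le f k) _ _) _.
  - by rewrite mulr_ge0 ?(ltW N0) // (depth_ge0 f).
  - by rewrite mulr_ge0 ?(ltW N0) // (depth_ge0 f').
  by rewrite -mulrBr normrM (ger0_norm (ltW N0)) -mulrA [scale4 k * _]mulrC.
have steps m k : `|depth D0 x k - depth D0' x' k| <=
    2 ^+ m * `|depth D0 x (m + k)%N - depth D0' x' (m + k)%N|.
  elim: m => [|m IH]; first by rewrite expr0 mul1r.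
  apply: le_trans IH _; rewrite exprSr -mulrA; apply: ler_wpM2l; first by rewrite exprn_ge0.
  exact: step.
have dd k : depth D0 x k = depth D0' x' k.
  apply/eqP; rewrite -subr_eq0 -normr_le0.
  have H m : `|depth D0 x k - depth D0' x' k| <= 2 * 2^-1 ^+ m.
    apply: le_trans (steps m k) _.
    have : `|depth D0 x (m + k)%N - depth D0' x' (m + k)%N| <= 2 * 4^-1 ^+ (m + k).
      apply: le_trans (ler_distD (depth_lim D0 x) _ _) _.
      have := depth_lim_le f (m + k); have := depth_lim_le f' (m + k).
      by rewrite ll [`|depth_lim _ _ - _|]distrC; lra.
    have : (4^-1 : R) ^+ (m + k) <= 4^-1 ^+ m.
      by apply: ler_wiXn2l; rewrite ?leq_addr // ?invr_ge0 // invf_le1 // ler1n.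
    move=> h1 h2; have -> : 2 * (2^-1 : R) ^+ m = 2 ^+ m * (2 * 4^-1 ^+ m).
      rewrite mulrCA; congr (2 * _); rewrite -exprMn; congr (_ ^+ m); lra.
    by rewrite ler_wpM2l ?exprn_ge0 //; lra.
  have /cvg_ge_cst : (fun m => 2 * (2^-1 : R) ^+ m) @ \oo --> (0 : R).
    by apply: geom_cvg0; lra.
  exact.
split; first exact: (dd 0%N).
move=> k; have [_ ->] := ga_run f k; have [_ ->] := ga_run f' k.
by rewrite rr soo dd.
Qed.

(** Runs the inverse stages down from depth [w] at stage [n] and puts zeros in the coordinates from
    [n] on. *)
Lemma process_back (s : nat -> R) (w : R) n : l1le1 s -> 0 <= w <= 1 ->
  exists D0 x, [/\ feasible D0 x, depth D0 x n = w & forall k, (k < n)%N -> out D0 x k = s k].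
Proof.
move=> s1 /andP[w0 w1]; pose N := @scale4 R; pose r k := 1 - psum s k.
have N0 k : 0 < N k by exact: scale4_gt0.
have r0 k : 0 <= r k <= 1 by have := s1 k; have := psum_ge0 s k; rewrite /r; lra.
have sr k : `|s k| <= r k by have := s1 k.+1; rewrite psumS /r; lra.
(* [back d k] is the depth at stage [k] when [w] is the depth at stage [k + d]; the recursion is on
   the number of stages to undo. *)
pose fix back (d k : nat) {struct d} : R :=
  if d is d'.+1 then ga_e (r k) (N k * back d' k.+1) (s k) / N k else w.
have back01 d k : 0 <= back d k <= 1.
  elim: d k => [|d IH] k /=; first by rewrite w0.
  have /andP[b0 b1] := IH k.+1.
  have Nb : 0 <= N k * back d k.+1 by rewrite mulr_ge0 // ltW.
  have [xr xe _ xE] := xi_ga (sr k) Nb.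
  rewrite divr_ge0 ?(ltW (N0 k)) ?(le_trans (normr_ge0 _) xe) //=.
  rewrite ler_pdivrMr // mul1r.
  (* Either the stage does not change the depth, or the rescaled depth is below
     [3 r k <= 3 < N k]. *)
  have [H|H] := leP (3 * r k) (ga_e (r k) (N k * back d k.+1) (s k)).
    rewrite -(xi_far xr xe H) xE ler_piMr // ltW //.
  by apply/ltW/(lt_le_trans H); have := @scale4_ge4 R k; have := r0 k; rewrite /N; lra.
pose D k := back (n - k)%N k.
pose x k := if (k < n)%N then ga_x (r k) (N k * D k.+1) (s k) else 0.
have D01 k : 0 <= D k <= 1 by exact: back01.
have DS k : (k < n)%N -> D k = ga_e (r k) (N k * D k.+1) (s k) / N k.
  by move=> kn; rewrite /D -(subnSK kn).
have ND k : (k < n)%N -> N k * D k = ga_e (r k) (N k * D k.+1) (s k).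
  by move=> kn; rewrite DS // mulrC divfK // gt_eqF.
have xi k : (k < n)%N -> [/\ `|x k| <= r k, `|x k| <= N k * D k,
    xi_s (r k) (N k * D k) (x k) = s k & xi_e (r k) (N k * D k) (x k) = N k * D k.+1].
  move=> kn; rewrite ND // /x kn; apply: xi_ga => //.
  by rewrite mulr_ge0 ?(ltW (N0 k)) //; case/andP: (D01 k.+1).
have rS k : r k.+1 = r k - `|s k| by rewrite /r psumS opprD addrA.
have lvlx k : (k <= n)%N -> Num.min (r k) (N k * D k) = Num.min 1 (4 * D 0%N) - psum x k.
  elim: k => [_|k IH kn]; first by rewrite /r !psum0 !subr0 /N /scale4 expr1.
  have [xr xe es eE] := xi k kn.
  rewrite psumS opprD addrA -IH ?(ltnW kn) // -[RHS]/(lvl _ _ _) -(xi_lvl xr xe) es eE.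
  by rewrite rS mulrA -scale4S.
have fe : feasible (D 0%N) x.
  split=> // m; have psx k : (n <= k)%N -> psum x k = psum x n.
    move=> /subnK <-; elim: (k - n)%N => [//|d IH].
    by rewrite addSn psumS IH /x ltnNge leq_addl normr0 addr0.
  have le_n k : (k <= n)%N -> psum x k <= Num.min 1 (4 * D 0%N).
    move=> kn; have := lvlx k kn; suff : 0 <= Num.min (r k) (N k * D k) by lra.
    rewrite le_min; have /andP[-> _] := r0 k; rewrite mulr_ge0 ?(ltW (N0 k)) //.
    by case/andP: (D01 k).
  by have [mn|nm] := leqP m n; [exact: le_n|rewrite psx ?(ltnW nm) // le_n].
have run k : (k <= n)%N -> room (D 0%N) x k = r k /\ depth (D 0%N) x k = D k.
  elim: k => [_|k IH kn]; first by rewrite /r psum0 subr0.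
  have [rk dk] := IH (ltnW kn); have [xr xe es eE] := xi k kn.
  rewrite roomS /out depthS rk dk es eE -rS; split => //.
  by rewrite mulrC mulKf // gt_eqF.
exists (D 0%N), x; split => //.
  by have [_ ->] := run n (leqnn n); rewrite /D subnn.
move=> k kn; have [rk dk] := run k (ltnW kn); have [_ _ es _] := xi k kn.
by rewrite /out rk dk.
Qed.

End process_bijective.

(** * Continuity of the process *)

Section process_continuous.
Context {R : realType} {X : topologicalType}.

Lemma continuous_ext (f g : X -> R) : f =1 g -> continuous f -> continuous g.
Proof. by move=> /funext ->. Qed.

Lemma continuous_fwd (t l q : X -> R) : continuous t -> continuous l -> continuous q ->
  continuous (fun y => fwd_s (l y) (q y)) /\ continuous (fun y => fwd_f (t y) (l y) (q y)).
Proof.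
move=> ct cl cq.
have cZ c (f : X -> R) : continuous f -> continuous (fun y => c * f y).
  by apply: continuous_mul; exact: continuous_cst.
split.
  apply: continuous_maxr; first exact: continuous_opp.
  by apply: continuous_minr => //; apply: cZ; exact: continuous_sub.
have cq2 : continuous (fun y => - 2 * q y) by apply: cZ.
have cqh : continuous (fun y => l y / 4 - q y / 2).
  by apply: continuous_sub; apply: continuous_mul => //; exact: continuous_cst.
apply: continuous_add; apply: continuous_maxr; try exact: continuous_cst.
  by apply: continuous_minr; [apply: continuous_add => //|apply: continuous_sub]; exact: cZ.
apply: continuous_maxr => //; apply: continuous_minr => //.
by apply: continuous_sub => //; exact: cZ.
Qed.

Lemma continuous_xi (r e x : X -> R) : continuous r -> continuous e -> continuous x ->
  (forall y, `|x y| <= r y) -> (forall y, `|x y| <= e y) ->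
  continuous (fun y => xi_s (r y) (e y) (x y)) /\
  continuous (fun y => xi_e (r y) (e y) (x y)).
Proof.
move=> cr ce cx xr xe.
have cl : continuous (fun y => lvl (r y) (e y) (x y)).
  by apply: continuous_sub; [exact: continuous_minr|exact: continuous_normr].
have crl := continuous_sub cr cl.
have [cs1 cf1] := continuous_fwd cl crl (continuous_sub ce cl).
have [cs2 cf2] := continuous_fwd cl crl (continuous_sub cl ce).
(* The two signs of [x] agree at 0: if [r <= e] then [l = 0] and [fwd_even] applies, otherwise
   [e = t] and both positions are 0. *)
have glue y : x y = 0 -> let t := lvl (r y) (e y) (x y) in
    fwd_s (r y - t) (e y - t) = fwd_s (r y - t) (t - e y) /\
    fwd_f t (r y - t) (e y - t) = fwd_f t (r y - t) (t - e y).
  move=> x0 t; have t0 : 0 <= t by rewrite subr_ge0 le_min xr xe.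
  have tE : t = Num.min (r y) (e y) by rewrite /t /lvl x0 normr0 subr0.
  have [re|er] := leP (r y) (e y).
    have -> : r y - t = 0 by rewrite tE min_l // subrr.
    have [a b] := fwd_even (t - e y) t0; rewrite opprB in a, b.
    by rewrite a b.
  by have -> : e y = t by rewrite tE min_r // ltW.
split.
  apply: (continuous_ext (f := fun y => if 0 <= x y
    then fwd_s (r y - lvl (r y) (e y) (x y)) (e y - lvl (r y) (e y) (x y))
    else fwd_s (r y - lvl (r y) (e y) (x y)) (lvl (r y) (e y) (x y) - e y))).
    by move=> y; rewrite /xi_s /pos; case: ifP.
  by apply: continuous_if_ge0 => // y x0; case: (glue y x0).
apply: continuous_add; first by apply: continuous_mul => //; exact: continuous_cst.
apply: (continuous_ext (f := fun y => if 0 <= x y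
    then fwd_f (lvl (r y) (e y) (x y)) (r y - lvl (r y) (e y) (x y)) (e y - lvl (r y) (e y) (x y))
    else fwd_f (lvl (r y) (e y) (x y)) (r y - lvl (r y) (e y) (x y)) (lvl (r y) (e y) (x y) - e y))).
  by move=> y; rewrite /pos; case: ifP.
by apply: continuous_if_ge0 => // y x0; case: (glue y x0).
Qed.

Section run.
Variables (D0 : X -> R) (x : X -> nat -> R).
Hypotheses (cD0 : continuous D0) (cx : forall k, continuous (fun y => x y k)).
Hypothesis feas : forall y, feasible (D0 y) (x y).

Lemma room_depth_continuous k :
  continuous (fun y => room (D0 y) (x y) k) /\ continuous (fun y => depth (D0 y) (x y) k).
Proof.
elim: k => [|k [cr cd]]; first by split => //; exact: continuous_cst.
have ce : continuous (fun y => scale4 k * depth (D0 y) (x y) k).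
  by apply: continuous_mul => //; exact: continuous_cst.
have [cs cE] := continuous_xi cr ce (@cx k)
  (fun y => (process_dom (feas y) k).1) (fun y => (process_dom (feas y) k).2).
split.
  apply: (continuous_ext (f := fun y => room (D0 y) (x y) k - `|out (D0 y) (x y) k|)).
    by move=> y; rewrite roomS.
  by apply: continuous_sub => //; exact: continuous_normr.
apply: continuous_ext (fun y => esym (depthS _ _ _)) _.
by apply: continuous_mul => //; exact: continuous_cst.
Qed.

Lemma out_continuous k : continuous (fun y => out (D0 y) (x y) k).
Proof.
have [cr cd] := room_depth_continuous k.
have ce : continuous (fun y => scale4 k * depth (D0 y) (x y) k).
  by apply: continuous_mul => //; exact: continuous_cst.
by have [] := continuous_xi cr ce (@cx k)
  (fun y => (process_dom (feas y) k).1) (fun y => (process_dom (feas y) k).2).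
Qed.

Lemma depth_lim_continuous : continuous (fun y => depth_lim (D0 y) (x y)).
Proof.
apply: (continuous_ulim (u := fun n y => depth (D0 y) (x y) n) (e := fun n => 4^-1 ^+ n)).
- by move=> n; case: (room_depth_continuous n).
- by move=> n y; exact: depth_lim_le.
- exact: quarter_cvg0.
Qed.

End run.

End process_continuous.

(** * Splitting a coordinate off the ball *)

Section split_coordinate.
Context {R : realType}.
Variable eta : R.
Hypothesis eta12 : 0 < eta <= 2^-1.

Let e0 : 0 < eta.
Proof. by case/andP: eta12. Qed.
Let e1 : 0 < 1 - eta.
Proof. by move: eta12; lra. Qed.

(* Chosen such that [shrink d * min 1 (4 * zeta d) = d]: dividing the
   coordinates [x_(k+1)] by [shrink d], where [d = 1 - |x_0|], makes the initial
   constraint [\sum_k |x_(k+1)| <= d] into the one of stage [0] for the depth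
   [zeta d].  The factor [shrink d] cannot be avoided: [phi] is [1] at a single
   point of [B], but on [[-1,1] * {0}] in [[-1,1] * B]. *)
Definition zeta (d : R) := Num.max (d / (4 * (1 - eta))) (1 - 3 / 4 * (1 - d) / eta).
Definition zeta_inv (D : R) := Num.min (4 * (1 - eta) * D) (1 - 4 / 3 * eta * (1 - D)).
Definition shrink (d : R) := Num.max d (1 - eta).

(** The two affine pieces meet at [d = 1 - eta] with value [1 / 4], and [eta <= 1 / 2] makes the
    second one steeper. *)
Lemma zetaE d : 0 <= d <= 1 ->
  zeta d = if d <= 1 - eta then d / (4 * (1 - eta)) else 1 - 3 / 4 * (1 - d) / eta.
Proof.
move=> /andP[d0 d1]; rewrite /zeta.
have -> : d / (4 * (1 - eta)) = 4^-1 - (1 - eta - d) * (1 - eta)^-1 / 4 by field; move: e1; lra.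
have -> : 1 - 3 / 4 * (1 - d) / eta = 4^-1 - 3 / 4 * (1 - eta - d) * eta^-1 by field; move: e0; lra.
have a2 : (1 - eta)^-1 <= 2.
  by rewrite -[2]invrK lef_pV2 ?posrE ?invr_gt0 //; move: eta12; lra.
have b2 : 2 <= eta^-1.
  by rewrite -[leLHS]invrK lef_pV2 ?posrE ?invr_gt0 //; move: eta12; lra.
case: ifP => [H|/negbT]; last rewrite -ltNge => H.
  by rewrite max_l //; nra.
by rewrite max_r //; nra.
Qed.

Lemma zeta_range d : 0 <= d <= 1 -> 0 <= zeta d <= 1.
Proof.
move=> /andP[d0 d1]; rewrite /zeta le_max ge_max divr_ge0 ?mulr_ge0 ?(ltW e1) //=.
apply/andP; split.
  by rewrite ler_pdivrMr ?mulr_gt0 //; move: eta12; lra.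
by rewrite gerBl divr_ge0 ?(ltW e0) // mulr_ge0 //; lra.
Qed.

Lemma zeta_shrink d : 0 <= d <= 1 -> shrink d * Num.min 1 (4 * zeta d) = d.
Proof.
move=> d01; rewrite zetaE // /shrink.
case: ifP => [H|/negbT]; last rewrite -ltNge => H.
  have -> : 4 * (d / (4 * (1 - eta))) = d / (1 - eta) by field; move: e1; lra.
  rewrite max_r // min_r; first by rewrite mulrC divfK // gt_eqF.
  by rewrite ler_pdivrMr // mul1r.
rewrite max_l ?(ltW H) // min_l ?mulr1 //.
suff : (1 - d) / eta <= 1 by lra.
by rewrite ler_pdivrMr //; lra.
Qed.

Lemma zeta_incr d d' : d < d' -> zeta d < zeta d'.
Proof.
move=> dd; rewrite /zeta gt_max !lt_max; apply/andP; split; apply/orP; [left|right].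
  by rewrite ltr_pM2r // invr_gt0 mulr_gt0.
by rewrite ltrD2l ltrN2 ltr_pM2r ?invr_gt0 //; lra.
Qed.

Lemma zeta_inj d d' : zeta d = zeta d' -> d = d'.
Proof.
move=> dd; apply/eqP; case: (ltgtP d d') => // /zeta_incr; rewrite dd ltxx //.
Qed.

Lemma zeta1 : zeta 1 = 1.
Proof.
rewrite zetaE ?lexx ?ler01 // ifF; first by rewrite subrr mulr0 mul0r subr0.
by apply/negbTE; rewrite -ltNge; move: e0; lra.
Qed.

Lemma zeta_invK D : 0 <= D <= 1 -> 0 <= zeta_inv D <= 1 /\ zeta (zeta_inv D) = D.
Proof.
move=> /andP[D0 D1]; rewrite /zeta_inv.
have [H|H] := leP D 4^-1.
  rewrite min_l; last by move: eta12; nra.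
  have r : 0 <= 4 * (1 - eta) * D <= 1 by move: eta12; nra.
  split => //; rewrite zetaE // ifT; last by move: e1; nra.
  by field; move: e1; lra.
rewrite min_r; last by move: eta12; nra.
have r : 0 <= 1 - 4 / 3 * eta * (1 - D) <= 1 by move: eta12; nra.
split => //; rewrite zetaE // ifF.
  by field; move: e0; lra.
by apply/negbTE; rewrite -ltNge; move: e0; nra.
Qed.

Lemma shrink_gt0 d : 0 < shrink d.
Proof. by rewrite lt_max e1 orbT. Qed.

Definition bdepth (z : l1_ball R nat) : R := 1 - `|bcrd z 0|.
Definition btail (z : l1_ball R nat) (k : nat) : R := bcrd z k.+1 / shrink (bdepth z).

Lemma bdepth01 z : 0 <= bdepth z <= 1.
Proof. by have := bcrd_norm z 0; have := normr_ge0 (bcrd z 0); rewrite /bdepth; lra. Qed.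

Lemma psum_btail z n :
  psum (bcrd z) n.+1 = `|bcrd z 0| + shrink (bdepth z) * psum (btail z) n.
Proof.
rewrite /psum big_ord_recl; congr (_ + _); rewrite mulr_sumr; apply: eq_bigr => i _.
have h := shrink_gt0 (bdepth z).
by rewrite /btail normrM [`|_^-1|]ger0_norm ?invr_ge0 ?(ltW h) // mulrC divfK // gt_eqF.
Qed.

Lemma btail_feasible z : feasible (zeta (bdepth z)) (btail z).
Proof.
split=> [|n]; first exact/zeta_range/bdepth01.
rewrite -(ler_pM2l (shrink_gt0 (bdepth z))) zeta_shrink ?bdepth01 //.
by have := bcrd_le1 z n.+1; rewrite psum_btail /bdepth; lra.
Qed.

Definition new_depth z := depth_lim (zeta (bdepth z)) (btail z).
Definition new_coord z : R := if 0 <= bcrd z 0 then 1 - new_depth z else - (1 - new_depth z).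
Definition new_tail z := ball_of (out_l1le1 (btail_feasible z)).

Lemma new_depth01 z : 0 <= new_depth z <= Num.max (zeta (bdepth z)) (3 / 4).
Proof.
have c := depth_cvg (btail_feasible z); apply/andP; split.
  by apply: (cvg_ge_cst c) => n; exact: depth_ge0 (btail_feasible z) n.
by apply: (cvg_le_cst c) => n; exact: depth_max (btail_feasible z) n.
Qed.

Lemma new_depth_le1 z : new_depth z <= 1.
Proof.
have /andP[_ h] := new_depth01 z; apply: le_trans h _.
by have /andP[_ h1] := zeta_range (bdepth01 z); rewrite ge_max h1; lra.
Qed.

(** The new coordinate takes its sign from [x_0]. For this to be continuous and invertible the two
    must vanish together; [depth_max] and [depth_eq1] give the two directions. *)
Lemma new_depth_eq1 z : new_depth z = 1 <-> bcrd z 0 = 0.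
Proof.
split=> [h|h].
  have /andP[_] := new_depth01 z; rewrite h le_max => /orP[zg|c]; last by exfalso; lra.
  have /andP[_ zl] := zeta_range (bdepth01 z).
  have : zeta (bdepth z) = zeta 1 by rewrite zeta1; apply/le_anti; rewrite zl zg.
  by move/zeta_inj; rewrite /bdepth => H; apply/normr0_eq0; lra.
have D1 : zeta (bdepth z) = 1 by rewrite /bdepth h normr0 subr0 zeta1.
apply: (cvg_uniq (depth_cvg (btail_feasible z))).
rewrite (_ : depth _ _ = fun=> 1); first exact: cvg_cst.
by apply/funext => k; exact: (depth_eq1 (btail_feasible z) k D1).
Qed.

Lemma new_coord_norm z : `|new_coord z| = 1 - new_depth z.
Proof.
by rewrite /new_coord; case: ifP => _; rewrite ?normrN ger0_norm // subr_ge0 new_depth_le1.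
Qed.

Lemma phi_new_tail z : phi (bcrd z) = shrink (bdepth z) * phi (bcrd (new_tail z)).
Proof.
rewrite (eq_phi (ball_ofK _)); apply: phiE; rewrite -cvg_shiftS.
have -> : (fun n => psum (bcrd z) n.+1) =
    fun n => `|bcrd z 0| + shrink (bdepth z) * psum (btail z) n.
  by apply/funext => n; exact: psum_btail.
(* By [zeta_shrink], the initial bound times [shrink d] is [d = 1 - |x_0|]. *)
have -> : 1 - shrink (bdepth z) * phi (out (zeta (bdepth z)) (btail z)) =
    `|bcrd z 0| + shrink (bdepth z) * (Num.min 1 (4 * zeta (bdepth z)) -
      phi (out (zeta (bdepth z)) (btail z))).
  have h := zeta_shrink (bdepth01 z); move: (phi _) => p.
  by rewrite mulrBr h /bdepth; lra.
apply: cvgD; first exact: cvg_cst.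
by apply: cvgMr; apply: phi_run; exact: btail_feasible.
Qed.

Definition split_fun (z : l1_ball R nat) : `[(-1 : R), 1]%classic * l1_ball R nat :=
  (seg (new_coord z), new_tail z).

Lemma new_coordK z : set_val (seg (new_coord z)) = new_coord z.
Proof. by rewrite segK // new_coord_norm gerBl; case/andP: (new_depth01 z). Qed.

Lemma bdepth_continuous : continuous bdepth.
Proof.
apply: continuous_sub; first exact: continuous_cst.
by apply: continuous_normr; exact: bcrd_continuous.
Qed.

Lemma shrink_continuous : continuous (fun z => shrink (bdepth z)).
Proof.
by apply: continuous_maxr; [exact: bdepth_continuous|exact: continuous_cst].
Qed.

Lemma split_fun_continuous : continuous split_fun.
Proof.
have cD : continuous (fun z => zeta (bdepth z)).
  apply: continuous_maxr; first apply: continuous_mul; try exact: continuous_cst.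
    exact: bdepth_continuous.
  apply: continuous_sub; first exact: continuous_cst.
  apply: continuous_mul; last exact: continuous_cst.
  apply: continuous_mul; first exact: continuous_cst.
  by apply: continuous_sub; [exact: continuous_cst|exact: bdepth_continuous].
have cx k : continuous (fun z => btail z k).
  apply: continuous_mul; first exact: bcrd_continuous.
  apply: continuous_inv shrink_continuous => z.
  by rewrite gt_eqF // shrink_gt0.
have c1 : continuous (fun z => seg (new_coord z)).
  apply: continuous_seg.
  apply: (continuous_ext (f := new_coord)); first by move=> z; rewrite new_coordK.
  have cl : continuous (fun z => 1 - new_depth z).
    apply: continuous_sub; first exact: continuous_cst.
    exact: depth_lim_continuous cD cx btail_feasible.
  apply: continuous_if_ge0 => //; [exact: bcrd_continuous|exact: continuous_opp|].
  by move=> z /new_depth_eq1 ->; rewrite subrr oppr0.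
have c2 : continuous new_tail.
  apply: continuous_l1_ball => k.
  apply: (continuous_ext (f := fun z => out (zeta (bdepth z)) (btail z) k)).
    by move=> z; rewrite ball_ofK.
  exact: (@out_continuous _ _ _ _ cD cx btail_feasible k).
exact: continuous_pair c1 c2.
Qed.

Lemma split_fun_inj : injective split_fun.
Proof.
move=> z z' zz; have c0 := congr1 (fun p => set_val p.1 : R) zz.
have ct k : bcrd (new_tail z) k = bcrd (new_tail z') k.
  exact: (congr1 (fun p => bcrd p.2 k) zz).
rewrite /= !new_coordK in c0.
have dl : new_depth z = new_depth z'.
  by have := congr1 Num.norm c0; rewrite !new_coord_norm; lra.
have [|zd tl] := process_inj (btail_feasible z) (btail_feasible z') _ dl.
  by move=> k; have := ct k; rewrite !ball_ofK.
have bd := zeta_inj zd.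
apply: bcrd_inj => -[|k]; last first.
  have := tl k; rewrite /btail bd; apply: mulIf.
  by rewrite invr_eq0 gt_eqF // shrink_gt0.
have nz : `|bcrd z 0| = `|bcrd z' 0| by move: bd; rewrite /bdepth; lra.
have [d1|d1] := eqVneq (new_depth z) 1.
  have -> : bcrd z 0 = 0 by apply/new_depth_eq1.
  by apply/esym/new_depth_eq1; rewrite -dl.
have {}d1 : new_depth z < 1 by rewrite lt_neqAle d1 new_depth_le1.
clear zz; move: c0 nz; rewrite /new_coord -dl.
have [a|a] := leP 0 (bcrd z 0); have [b|b] := leP 0 (bcrd z' 0) => // H.
- by rewrite !ger0_norm.
- by exfalso; lra.
- by exfalso; lra.
- by rewrite !ltr0_norm // => /oppr_inj.
Qed.

Lemma split_fun_approx (w : `[(-1 : R), 1]%classic) (y : l1_ball R nat) n :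
  exists z, `|new_coord z - set_val w| <= 4^-1 ^+ n /\
    forall k, (k < n)%N -> bcrd (new_tail z) k = bcrd y k.
Proof.
have w1 := seg_norm w; have w0 := normr_ge0 (set_val w : R).
have w01 : 0 <= 1 - `|set_val w| <= 1 by lra.
(* The depth after [n] stages is prescribed as [1 - |w|]; the limit depth then differs from it by at
   most [4 ^ (- n)]. *)
have [D0 [x [fe dn on]]] := process_back n (bcrd_le1 y) w01.
have [d01 zd] := zeta_invK fe.1; set d := zeta_inv D0 in d01 zd.
pose z0 : R := if 0 <= set_val w then 1 - d else - (1 - d).
pose u k := if k is k'.+1 then shrink d * x k' else z0.
have z0n : `|z0| = 1 - d.
  by rewrite /z0; case: ifP => _; rewrite ?normrN ger0_norm //; lra.
have u1 : l1le1 u.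
  move=> m; apply: le_trans (psum_incr _ _) _.
  rewrite /psum big_ord_recl /= z0n.
  under eq_bigr do rewrite /= normrM (ger0_norm (ltW (shrink_gt0 d))).
  rewrite -mulr_sumr.
  have := fe.2 m; rewrite -zd -(ler_pM2l (shrink_gt0 d)) zeta_shrink // /psum; lra.
pose z := ball_of u1.
have zd0 : bdepth z = d by rewrite /bdepth ball_ofK z0n; lra.
have zx : btail z = x.
  apply/funext => k; rewrite /btail zd0 ball_ofK /= mulrC mulKf //.
  by rewrite gt_eqF // shrink_gt0.
exists z; split; last first.
  by move=> k kn; rewrite ball_ofK zd0 zx zd; exact: on.
have nd : `|1 - `|set_val w| - new_depth z| <= 4^-1 ^+ n.
  by rewrite -dn -{1}zd -zd0 -zx; apply: depth_lim_le; exact: btail_feasible.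
rewrite /new_coord ball_ofK /= /z0.
have [wp|wn] := leP 0 (set_val w : R).
  rewrite (ger0_norm wp) in nd; rewrite ifT; last by lra.
  by move: nd; rewrite !ler_norml; lra.
rewrite (ltr0_norm wn) in nd.
(* A negative [w] needs [z0] strictly negative. If [d = 1], the depth would stay 1 through all
   stages, against [1 - |w| < 1]. *)
have d1 : d < 1.
  rewrite lt_neqAle; case/andP: d01 => _ ->; rewrite andbT; apply/eqP => d1.
  have D1 : D0 = 1 by rewrite -zd d1 zeta1.
  have := depth_eq1 fe n D1; rewrite dn ltr0_norm //; lra.
rewrite ifF; first by move: nd; rewrite !ler_norml; lra.
by apply/negbTE; rewrite -ltNge; lra.
Qed.

Lemma split_ball : exists (f : l1_ball R nat -> `[(-1 : R), 1]%classic * l1_ball R nat) g (t : _ -> R),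
  [/\ cancel f g, cancel g f, continuous f, continuous g & continuous t] /\
  forall z, 1 - eta <= t z <= 1 /\ phi (bcrd z) = t z * phi (bcrd (f z).2).
Proof.
have hY : hausdorff_space (`[(-1 : R), 1]%classic * l1_ball R nat)%type.
  by apply: hausdorff_pair; [exact: seg_hausdorff|exact: l1_ball_hausdorff].
have cX := @l1_ball_compact R nat.
have [g [fg gf cg]] : exists g, [/\ cancel split_fun g, cancel g split_fun & continuous g].
  apply: (compact_bij_homeo cX hY split_fun_continuous split_fun_inj) => -[w y].
  have [z zP] := choice (split_fun_approx w y).
  apply: (@approx_surj _ _ split_fun (w, y) z) => //; first exact: split_fun_continuous.
  apply: (cvg_pair (G := nbhs w) (H := nbhs y) (f := fun n => seg (new_coord (z n)))
    (g := fun n => new_tail (z n))).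
    apply: cvg_set_type; apply/subr_cvg0; apply: (cvg0_le _ (@quarter_cvg0 R)) => n.
    by have [+ _] := zP n; rewrite new_coordK.
  apply: (cvg_l1_ball (x := fun n => new_tail (z n))) => k.
  apply: cvg_near_cst; exists k.+1 => // n /= kn.
  by have [_] := zP n; apply.
exists split_fun, g, (fun z => shrink (bdepth z)); split.
  by split => //; [exact: split_fun_continuous|exact: shrink_continuous].
move=> z; split; last exact: phi_new_tail.
by have := bdepth01 z; rewrite /shrink le_max ge_max lexx orbT /=; move: e0; lra.
Qed.

End split_coordinate.

(** * Freeing countably many coordinates *)

Section double_product.
Context {R : realType}.
Variables (c : nat -> R) (b : nat * nat -> nat) (b' : nat -> nat * nat).
Hypotheses (c01 : forall n, 0 <= c n <= 1) (bK : cancel b b') (b'K : cancel b' b).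

Lemma prod_subset (s s' : seq nat) : uniq s -> uniq s' -> {subset s <= s'} ->
  \prod_(k <- s') c k <= \prod_(k <- s) c k.
Proof.
move=> us us' ss; rewrite (perm_big (s ++ [seq k <- s' | k \notin s])).
  rewrite big_cat /= ler_piMr ?prodr_ge0 // => [k _|]; first by case/andP: (c01 k).
  by apply: prodr_ile1 => k _.
apply: uniq_perm => //; first rewrite cat_uniq us filter_uniq // andbT /=.
  by apply/hasPn => k; rewrite mem_filter => /andP[].
move=> k; rewrite mem_cat mem_filter; case ks: (k \in s) => //=.
by rewrite ss.
Qed.

Let rect m l := [seq b (j, i) | j <- iota 0 m, i <- iota 0 l].
Let row j := fun i => c (b (j, i)).

Lemma prod_rect m l : \prod_(k <- rect m l) c k = pprod (fun j => pprod (row j) l) m.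
Proof.
rewrite /rect big_allpairs_dep /pprod -(big_mkord xpredT (fun j => \prod_(i < l) row j i)).
rewrite /index_iota subn0; apply: eq_bigr => j _.
by rewrite -(big_mkord xpredT (row j)) /index_iota subn0.
Qed.

Lemma rect_uniq m l : uniq (rect m l).
Proof.
apply: allpairs_uniq; rewrite ?iota_uniq // => -[j i] [j' i'] _ _ /=.
by move/(can_inj bK).
Qed.

Lemma mem_rect n m l : ((b' n).1 < m)%N -> ((b' n).2 < l)%N -> n \in rect m l.
Proof.
move=> h1 h2; apply/allpairsP; exists (b' n); rewrite !mem_iota /=.
by split => //; rewrite -surjective_pairing b'K.
Qed.

Lemma pprod_iota n : pprod c n = \prod_(k <- iota 0 n) c k.
Proof. by rewrite /pprod -(big_mkord xpredT c) /index_iota subn0. Qed.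

Lemma row01 j i : 0 <= row j i <= 1.
Proof. exact: c01. Qed.

Lemma pinf_row01 j : 0 <= pinf (row j) <= 1.
Proof. by rewrite pinf_ge0 ?pinf_le1 // => i; exact: row01. Qed.

(** Factors at most 1 make products decrease as index sets grow; every finite rectangle lies in an
    initial segment and conversely. *)
Lemma pinf_double : pinf c = pinf (fun j => pinf (row j)).
Proof.
apply/le_anti/andP; split.
  apply: (cvg_ge_cst (pinf_cvg pinf_row01)) => m.
  have cl : (fun l => pprod (fun j => pprod (row j) l) m) @ \oo -->
      pprod (fun j => pinf (row j)) m.
    rewrite /pprod; apply: (@cvg_big R _ _ _ _ mul_continuous) => j _.
    exact: pinf_cvg (row01 j).
  apply: (cvg_ge_cst cl) => l; rewrite -prod_rect.
  pose N := (\max_(k <- rect m l) k).+1.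
  apply: le_trans (pinf_le c01 N) _; rewrite pprod_iota.
  apply: prod_subset; rewrite ?rect_uniq ?iota_uniq // => k kr.
  rewrite mem_iota add0n ltnS leq0n /=.
  exact: (@leq_bigmax_seq _ _ xpredT (fun j => j) k).
apply: (cvg_ge_cst (pinf_cvg c01)) => n.
pose m := (\max_(k <- iota 0 n) (b' k).1).+1.
pose l := (\max_(k <- iota 0 n) (b' k).2).+1.
apply: le_trans (pinf_le pinf_row01 m) _.
apply: le_trans (_ : pprod (fun j => pprod (row j) l) m <= _).
  rewrite /pprod; apply: ler_prod => j _; rewrite -/(pprod (row j) l).
  by rewrite (pinf_le (row01 j)) andbT; case/andP: (pinf_row01 j).
rewrite -prod_rect pprod_iota; apply: prod_subset; rewrite ?rect_uniq ?iota_uniq //.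
move=> k kn; apply: mem_rect; rewrite ltnS.
  exact: (@leq_bigmax_seq _ _ xpredT (fun k => (b' k).1) k).
exact: (@leq_bigmax_seq _ _ xpredT (fun k => (b' k).2) k).
Qed.

End double_product.

Section cube_stability.
Context {R : realType}.

Definition weight (v : cube R nat) : R := pinf (fun i => 1 - `|crd v i|).

Lemma weight_fact01 (v : cube R nat) i : 0 <= 1 - `|crd v i| <= 1.
Proof. by have := crd_norm v i; have := normr_ge0 (crd v i); lra. Qed.

(** [split_ball] conjugated by [collapse_homeo]. *)
Lemma split_cube (eta : R) : 0 < eta <= 2^-1 ->
  exists (f : cube R nat -> `[(-1 : R), 1]%classic * cube R nat) g (t : _ -> R),
  [/\ cancel f g, cancel g f, continuous f, continuous g & continuous t] /\
  forall v, 1 - eta <= t v <= 1 /\ weight v = t v * weight (f v).2.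
Proof.
move=> /split_ball [f [g [t [[fg gf cf cg ct] ft]]]].
have [h [k [hk kh ch ck hw]]] := @collapse_homeo R.
exists (fun v => ((f (h v)).1, k (f (h v)).2)), (fun p => k (g (p.1, h p.2))), (t \o h).
have cfh : continuous (fun v => f (h v)) := continuous_after cf ch.
split; last first.
  by move=> v; have [? e] := ft (h v); split => //; rewrite /weight -!hw kh e.
split.
- by move=> v; rewrite /= kh -surjective_pairing fg hk.
- by move=> [w v]; rewrite /= kh gf /= hk.
- apply: continuous_pair; first exact: continuous_after (@fst_continuous _ _) cfh.
  exact: continuous_after ck (continuous_after (@snd_continuous _ _) cfh).
- apply: continuous_after ck _; apply: continuous_after cg _; apply: continuous_pair.
    exact: fst_continuous.
  exact: continuous_after ch (@snd_continuous _ _).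
- exact: continuous_after ct ch.
Qed.

End cube_stability.

(** * Absorbing a whole cube *)

Section cube_power.
Context {R : realType}.

(** These sum to at most [1 / 2], so a product of factors [>= 1 - eta j] stays at least [1 / 2]. *)
Let eta (j : nat) : R := 2^-1 ^+ j.+2.

Lemma eta_sum n k : \sum_(i < k) eta (n + i) <= 2^-1 ^+ n.+1.
Proof.
suff : \sum_(i < k) eta (n + i) <= 2^-1 ^+ n.+1 - 2^-1 ^+ (n + k).+1.
  have : 0 <= (2^-1 : R) ^+ (n + k).+1 by rewrite exprn_ge0 // invr_ge0.
  by lra.
elim: k => [|k IH]; first by rewrite big_ord0 addn0 subrr.
by rewrite big_ord_recr /= addnS /eta [_ ^+ (n + k).+2]exprS; lra.
Qed.

Lemma eta_bounds j : 0 < eta j <= 2^-1.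
Proof.
rewrite exprn_gt0 ?invr_gt0 //= -[leRHS]expr1; exact: half_expr_mono.
Qed.

Lemma nat2_bij : exists (b : nat * nat -> nat) b', cancel b b' /\ cancel b' b.
Proof.
have /pcard_eqP[f] := card_nat2; have [g fg gf] := @bijTT _ _ f.
by exists f, g.
Qed.

(** The bijection [b] arranges the coordinates in rows [blk v j]. One coordinate is split off each
    row; these form the first cube, and the remainders are put back as the rows of the second. The
    factors of the rows multiply to [t]. *)
Lemma cube_power : exists (f : cube R nat -> cube R nat * cube R nat) g (t : _ -> R),
  [/\ cancel f g, cancel g f, continuous f, continuous g & continuous t] /\
  forall v, 0 < t v /\ weight v = t v * weight (f v).2.
Proof.
have [F FP] := choice (fun j => split_cube (eta_bounds j)).
have [G GP] := choice FP; have [t tP] := choice GP.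
have [b [b' [bK b'K]]] := nat2_bij.
pose blk (v : cube R nat) j : cube R nat := fun i => v (b (j, i)).
have cblk j : continuous (blk^~ j).
  by apply: continuous_cube => k; exact: crd_continuous.
have FG j := (tP j).1; have tE j := (tP j).2.
have t01 v j : 0 <= t j (blk v j) <= 1.
  by have [] := tE j (blk v j); have := eta_bounds j; lra.
exists (fun v => (fun j => (F j (blk v j)).1, fun n => (F (b' n).1 (blk v (b' n).1)).2 (b' n).2)).
exists (fun p => fun n => G (b' n).1 (p.1 (b' n).1, blk p.2 (b' n).1) (b' n).2).
exists (fun v => pinf (fun j => t j (blk v j))).
have tsum v n k : \sum_(i < k) (1 - t (n + i)%N (blk v (n + i)%N)) <= 2^-1 ^+ n.+1.
  apply: le_trans (eta_sum n k); apply: ler_sum => i _.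
  by have [] := tE (n + i)%N (blk v (n + i)%N); lra.
split; last first.
  move=> v; split.
    have := pinf_ge (t01 v) (tsum v 0%N); rewrite expr1; lra.
  rewrite /weight (pinf_double (weight_fact01 v) bK b'K).
  rewrite (pinf_double (weight_fact01 _) bK b'K) -pinfM //; last first.
    by move=> j; exact: (@pinf_row01 _ _ b (weight_fact01 _) j).
  congr pinf; apply/funext => j.
  have [_] := tE j (blk v j); rewrite /weight => ->; congr (_ * pinf _).
  by apply/funext => i; rewrite /crd /= bK.
split.
- move=> v; apply/funext => n /=.
  have -> : blk (fun n => (F (b' n).1 (blk v (b' n).1)).2 (b' n).2) (b' n).1 =
      (F (b' n).1 (blk v (b' n).1)).2.
    by apply/funext => i; rewrite /blk bK.
  rewrite -surjective_pairing; have [-> _ _ _ _] := FG (b' n).1.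
  by rewrite /blk -surjective_pairing b'K.
- move=> [w v] /=; pose z n := G (b' n).1 (w (b' n).1, blk v (b' n).1) (b' n).2.
  have zE j : blk z j = G j (w j, blk v j) by apply/funext => i; rewrite /blk /z bK.
  have FE j : F j (blk z j) = (w j, blk v j) by rewrite zE; have [_ -> _ _ _] := FG j.
  congr pair; apply/funext => n; first by rewrite -/z FE.
  by rewrite -/z FE /blk /= -surjective_pairing b'K.
- have cF j : continuous (fun v => F j (blk v j)).
    by apply: continuous_after (cblk j); have [_ _ + _ _] := FG j.
  apply: continuous_pair.
    apply: (@continuous_ptws _ `[(-1 : R), 1]%classic nat) => n.
    exact: continuous_after (@fst_continuous _ _) (cF n).
  apply: (@continuous_ptws _ `[(-1 : R), 1]%classic nat) => n.
  apply: (continuous_after (g := fun u : cube R nat => u (b' n).2)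
    (f := fun v => (F (b' n).1 (blk v (b' n).1)).2)).
    exact: ptws_proj_continuous.
  exact: continuous_after (@snd_continuous _ _) (cF (b' n).1).
- apply: (@continuous_ptws _ `[(-1 : R), 1]%classic nat) => n; set j := (b' n).1.
  apply: (continuous_after (g := fun u : cube R nat => u (b' n).2)
    (f := fun p : cube R nat * cube R nat => G j (p.1 j, blk p.2 j))).
    exact: ptws_proj_continuous.
  apply: continuous_after; first by have [_ _ _ + _] := FG j; exact.
  apply: continuous_pair.
    apply: (continuous_after (g := fun u : cube R nat => u j) (f := fst)).
      exact: ptws_proj_continuous.
    exact: fst_continuous.
  exact: continuous_after (cblk j) (@snd_continuous _ _).
- apply: (pinf_continuous (e := fun n => 2^-1 ^+ n.+1)) => //.
    by move=> j; apply: continuous_after (cblk j); have [_ _ _ _ +] := FG j.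
  by have H := @half_cvg0 R; rewrite -cvg_shiftS in H; exact: H.
Qed.

End cube_power.

(** * Transfer to the ball over nat and the Hilbert cube *)

Section ball_stability.
Context {R : realType}.

Lemma clamp01_in (x : R) : `[(0 : R), 1]%classic (Num.max 0 (Num.min 1 x)).
Proof.
by rewrite /= in_itv /= le_max lexx /= ge_max ge_min lexx ler01.
Qed.

Definition seg01 (x : R) : `[(0 : R), 1]%classic := SigSub (mem_set (clamp01_in x)).

Lemma seg01K (x : R) : 0 <= x <= 1 -> set_val (seg01 x) = x.
Proof. by move=> /andP[x0 x1]; rewrite set_valE /= min_r // max_r. Qed.

Definition to_hilbert (w : cube R nat) : hilbert_cube R :=
  fun n => seg01 ((crd w n + 1) / 2).
Definition of_hilbert (q : hilbert_cube R) : cube R nat :=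
  cube_of (fun n => 2 * set_val (q n) - 1).

Lemma hilbert_bounds (q : hilbert_cube R) n : 0 <= set_val (q n) <= 1.
Proof. by have := set_valP (q n); rewrite /= in_itv. Qed.

Lemma to_hilbert_val w n : set_val (to_hilbert w n) = (crd w n + 1) / 2.
Proof. by apply: seg01K; have := crd_norm w n; rewrite ler_norml; lra. Qed.

Lemma of_hilbert_crd q n : crd (of_hilbert q) n = 2 * set_val (q n) - 1.
Proof. by apply: cube_ofK; have := hilbert_bounds q n; rewrite ler_norml; lra. Qed.

Lemma to_hilbertK : cancel to_hilbert of_hilbert.
Proof.
by move=> w; apply: crd_inj => n; rewrite of_hilbert_crd to_hilbert_val; lra.
Qed.

Lemma of_hilbertK : cancel of_hilbert to_hilbert.
Proof.
move=> q; apply/funext => n; apply: val_inj.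
have := to_hilbert_val (of_hilbert q) n; rewrite of_hilbert_crd !set_valE => ->.
by lra.
Qed.

Lemma to_hilbert_continuous : continuous to_hilbert.
Proof.
apply: continuous_ptws => n; apply: continuous_set_type.
apply: (continuous_ext (f := fun w => (crd w n + 1) / 2)).
  by move=> w; rewrite /= to_hilbert_val.
apply: continuous_mul; last exact: continuous_cst.
by apply: continuous_add; [exact: crd_continuous|exact: continuous_cst].
Qed.

Lemma of_hilbert_continuous : continuous of_hilbert.
Proof.
apply: continuous_cube => n.
apply: (continuous_ext (f := fun q : hilbert_cube R => 2 * set_val (q n) - 1)).
  by move=> w; rewrite /= of_hilbert_crd.
apply: continuous_sub; last exact: continuous_cst.
apply: continuous_mul; first exact: continuous_cst.
apply: continuous_after; first exact: set_val_continuous.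
exact: ptws_proj_continuous.
Qed.

(** [cube_power] conjugated by [collapse_homeo], with the spare cube rescaled affinely. *)
Lemma nat_ball_stable :
  exists (f : l1_ball R nat -> (l1_ball R nat * hilbert_cube R)%type) g (t : _ -> R),
  [/\ cancel f g, cancel g f, continuous f, continuous g & continuous t] /\
  forall x, 0 < t x /\ phi (bcrd x) = t x * phi (bcrd (f x).1).
Proof.
have [f [g [t [[fg gf cf cg ct] ft]]]] := @cube_power R.
have [h [k [hk kh ch ck hw]]] := @collapse_homeo R.
exists (fun x => (h (f (k x)).2, to_hilbert (f (k x)).1)).
exists (fun p => h (g (of_hilbert p.2, k p.1))), (t \o k).
have cfk : continuous (fun x => f (k x)) := continuous_after cf ck.
split; last first.
  move=> x; have [t0 e] := ft (k x); split => //=.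
  by rewrite -{1}[x]kh !hw -/(weight _) e.
split.
- by move=> x /=; rewrite to_hilbertK hk -surjective_pairing fg kh.
- by move=> [x q] /=; rewrite hk gf /= kh of_hilbertK.
- apply: continuous_pair.
    exact: continuous_after ch (continuous_after (@snd_continuous _ _) cfk).
  apply: continuous_after to_hilbert_continuous _.
  exact: continuous_after (@fst_continuous _ _) cfk.
- apply: continuous_after ch _; apply: continuous_after cg _; apply: continuous_pair.
    exact: continuous_after of_hilbert_continuous (@snd_continuous _ _).
  exact: continuous_after ck (@fst_continuous _ _).
- exact: continuous_after ct ck.
Qed.

End ball_stability.

(** * The ball over an infinite set *)

Section replace_coordinates.
Context {R : realType} {K : choiceType}.
Variable e : nat -> K.
Hypothesis e_inj : injective e.

Lemma pull_l1le1 (z : l1_ball R K) : l1le1 (bcrd z \o e).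
Proof.
move=> n; have /l1_ballP/(_ (map e (iota 0 n))) := set_valP z.
rewrite map_inj_uniq // iota_uniq big_map => /(_ isT).
by rewrite -{1}(subn0 n) -/(index_iota 0 n) big_mkord.
Qed.

Definition pull z := ball_of (pull_l1le1 z).

Lemma pullE z i : bcrd (pull z) i = bcrd z (e i).
Proof. exact: ball_ofK. Qed.

Definition idx (k : K) : option nat :=
  if pselect (exists i, e i = k) is left h then Some (projT1 (cid h)) else None.

Lemma idx_e i : idx (e i) = Some i.
Proof.
rewrite /idx; case: pselect => [h|[]]; last by exists i.
by case: cid => j /= /e_inj ->.
Qed.

Lemma idx_some k i : idx k = Some i -> e i = k.
Proof. by rewrite /idx; case: pselect => // h [<-]; case: cid. Qed.

(** Encodes the pair [(x, c y)], where [y] consists of the coordinates of [z] outside the range of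
    [e]. *)
Definition glue (z : l1_ball R K) (x : l1_ball R nat) (c : R) (k : K) : R :=
  if idx k is Some i then bcrd x i else c * bcrd z k.

Lemma sum_glue z x c s : 0 <= c -> \sum_(k <- s) `|glue z x c k| =
  \sum_(i <- pmap idx s) `|bcrd x i| + c * \sum_(k <- s | ~~ idx k) `|bcrd z k|.
Proof.
move=> c0; elim: s => [|k s IH]; first by rewrite !big_nil mulr0 addr0.
rewrite !big_cons IH /= /glue; case: (idx k) => [i|] /=.
  by rewrite big_cons addrA.
by rewrite normrM (ger0_norm c0) mulrDr addrCA.
Qed.

(** Indices in the range of [e] and indices outside it are disjoint, so the two finite sums together
    are at most 1. *)
Lemma sum_off_le (z : l1_ball R K) s : uniq s ->
  \sum_(k <- s | ~~ idx k) `|bcrd z k| <= phi (bcrd (pull z)).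
Proof.
move=> us; apply: phi_ge; first exact: bcrd_le1.
move=> n; have /l1_ballP/(_ (map e (iota 0 n) ++ [seq k <- s | ~~ idx k])) := set_valP z.
rewrite cat_uniq map_inj_uniq // iota_uniq filter_uniq // andbT big_cat big_filter big_map /=.
have -> : ~~ has (fun k => k \in map e (iota 0 n)) [seq k <- s | ~~ idx k].
  apply/hasPn => k; rewrite mem_filter => /andP[+ _].
  by apply: contra => /mapP[i _ ->]; rewrite idx_e.
move=> /(_ isT) H; have -> : psum (bcrd (pull z)) n = \sum_(i <- iota 0 n) `|bcrd z (e i)|.
  rewrite /psum -(subn0 n) -/(index_iota 0 n) big_mkord subn0.
  by apply: eq_bigr => i _; rewrite pullE.
by move: H; rewrite /bcrd; lra.
Qed.

Lemma glue_sum_le1 z x c s : 0 <= c -> c * phi (bcrd (pull z)) <= phi (bcrd x) ->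
  uniq s -> \sum_(k <- s) `|glue z x c k| <= 1.
Proof.
move=> c0 cp us; rewrite sum_glue //.
have up : uniq (pmap idx s).
  apply: (pmap_uniq (g := e)) us => k; rewrite /omap /oapp.
  by case ik: (idx k) => [i|] //=; rewrite (idx_some ik).
have [n h1] := sum_le_psum (bcrd x) up.
have h2 := psum_le_phi n (bcrd_le1 x).
have h3 := ler_wpM2l c0 (sum_off_le z us).
lra.
Qed.

Section glued.
Variables (z : l1_ball R K) (x : l1_ball R nat) (c : R).
Hypotheses (c0 : 0 <= c) (cp : c * phi (bcrd (pull z)) <= phi (bcrd x)).

Lemma glue_norm k : `|glue z x c k| <= 1.
Proof. by have := glue_sum_le1 (s := [:: k]) c0 cp isT; rewrite big_seq1. Qed.

Lemma glue_l1 : l1_ball_set R K (cube_of (glue z x c)).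
Proof.
apply/l1_ballP => s us; under eq_bigr do rewrite cube_ofK ?glue_norm //.
exact: glue_sum_le1.
Qed.

Definition glue_ball : l1_ball R K := SigSub (mem_set glue_l1).

Lemma glue_ballE k : bcrd glue_ball k = glue z x c k.
Proof. by rewrite /bcrd set_valE /= cube_ofK // glue_norm. Qed.

Lemma pull_glue : pull glue_ball = x.
Proof. by apply: bcrd_inj => i; rewrite pullE glue_ballE /glue idx_e. Qed.

End glued.

Lemma pull_continuous : continuous pull.
Proof.
apply: continuous_l1_ball => i.
by apply: (continuous_ext (f := fun z => bcrd z (e i))) => [z|];
  [rewrite pullE|exact: bcrd_continuous].
Qed.

Lemma glue_continuous (X : topologicalType) (z : X -> l1_ball R K) (x : X -> l1_ball R nat)
    (c : X -> R) k : continuous z -> continuous x -> continuous c ->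
  continuous (fun y => glue (z y) (x y) (c y) k).
Proof.
move=> cz cx cc; rewrite /glue; case: (idx k) => [i|].
  exact: continuous_after (@bcrd_continuous _ _ i) cx.
apply: continuous_mul => //.
exact: continuous_after (@bcrd_continuous _ _ k) cz.
Qed.

End replace_coordinates.

Theorem corollary2 (R : realType) (K : choiceType)
    (K_infinite : infinite_set [set: K]%classic) :
  homeomorphic (l1_ball R K) (l1_ball R K * hilbert_cube R)%type.
Proof.
have [e e_inj] : exists e : nat -> K, injective e.
  have /infiniteP/card_leP[f] := K_infinite.
  exists (fun n => set_val (f (SigSub (mem_set (I : [set: nat] n))))) => m n /val_inj.
  by move/(@inj _ _ _ f) => /(_ (mem_set I) (mem_set I)) /(congr1 set_val).
have [f [g [t [[fg gf cf cg ct] ft]]]] := @nat_ball_stable R.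
have t0 x : 0 < t x by case: (ft x).
have tV0 x : 0 <= (t x)^-1 by rewrite invr_ge0 ltW.
have fwdP (z : l1_ball R K) : (t (pull e_inj z))^-1 * phi (bcrd (pull e_inj z)) <=
    phi (bcrd (f (pull e_inj z)).1).
  by have [_ ->] := ft (pull e_inj z); rewrite mulKf // gt_eqF.
have bwdP (p : l1_ball R K * hilbert_cube R) :
    t (g (pull e_inj p.1, p.2)) * phi (bcrd (pull e_inj p.1)) <=
    phi (bcrd (g (pull e_inj p.1, p.2))).
  by have [_ ->] := ft (g (pull e_inj p.1, p.2)); rewrite gf.
(* Since [phi x = t x * phi (f x).1], division by [t x] turns the bound [phi x] on the coordinates
   off the range of [e] into the bound required beside [(f x).1]; [G] multiplies back. *)
pose F z := (glue_ball (tV0 _) (fwdP z), (f (pull e_inj z)).2).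
pose G p := glue_ball (ltW (t0 _)) (bwdP p).
have cp := @pull_continuous R K e e_inj.
have cfp := continuous_after cf cp.
have cgp : continuous (fun p : l1_ball R K * hilbert_cube R => g (pull e_inj p.1, p.2)).
  apply: continuous_after cg _; apply: continuous_pair; last exact: snd_continuous.
  exact: continuous_after cp (@fst_continuous _ _).
have FE z k : bcrd (F z).1 k = glue e z (f (pull e_inj z)).1 (t (pull e_inj z))^-1 k.
  exact: glue_ballE.
have GE p k : bcrd (G p) k =
    glue e p.1 (g (pull e_inj p.1, p.2)) (t (g (pull e_inj p.1, p.2))) k.
  exact: glue_ballE.
have pF z : pull e_inj (F z).1 = (f (pull e_inj z)).1 by exact: pull_glue.
have pG p : pull e_inj (G p) = g (pull e_inj p.1, p.2) by exact: pull_glue.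
exists F, G; split.
- move=> z; apply: bcrd_inj => k; rewrite GE pF /= -surjective_pairing fg /glue.
  case ik: (idx e k) => [i|]; first by rewrite pullE (idx_some ik).
  by rewrite FE /glue ik mulrA mulfV ?mul1r // gt_eqF.
- move=> p; have F2 : (F (G p)).2 = p.2 by rewrite /= pG gf.
  rewrite [LHS]surjective_pairing [RHS]surjective_pairing F2; congr pair.
  apply: bcrd_inj => k; rewrite FE pG gf /glue.
  case ik: (idx e k) => [i|]; first by rewrite pullE (idx_some ik).
  by rewrite GE /glue ik mulrA mulVf ?mul1r // gt_eqF.
- apply: continuous_pair; last exact: continuous_after (@snd_continuous _ _) cfp.
  apply: continuous_l1_ball => k.
  apply: (continuous_ext (f := fun z => glue e z (f (pull e_inj z)).1 (t (pull e_inj z))^-1 k)).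
    by move=> z; rewrite -FE.
  apply: glue_continuous => [z|| ]; first exact: cvg_id.
    exact: continuous_after (@fst_continuous _ _) cfp.
  apply: continuous_inv; first by move=> z; rewrite gt_eqF.
  exact: continuous_after ct cp.
- apply: continuous_l1_ball => k.
  apply: (continuous_ext (f := fun p => glue e p.1 (g (pull e_inj p.1, p.2))
    (t (g (pull e_inj p.1, p.2))) k)).
    by move=> p; rewrite -GE.
  apply: glue_continuous => //; first exact: fst_continuous.
  exact: continuous_after ct cgp.
Qed.
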